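(* Assume the axiom of choice. Let $(\mathfrak g,\top)$ be a locality Lie algebra over $\mathbb{K}$ such that (a) for every $n\in\mathbb{N}$ the subspace $I^n_{\rm mult}(\mathfrak g)\cap F^n(\mathfrak g)\subset F^n(\mathfrak g)$ is locality compatible with $\top^n_\times$; (b) the ideal $J_\top(\mathfrak g)$ of $\mathcal{T}_\top(\mathfrak g)$ is locality compatible with $\top_\otimes$. Then the set of primitive elements of the locality universal enveloping algebra $U_\top(\mathfrak g)$ coincides with $\iota_{\mathfrak g}(\mathfrak g)$: $${\rm Prim}(U_\top(\mathfrak g))=\iota_{\mathfrak g}(\mathfrak g),$$ where $\iota_{\mathfrak g}$ is the canonical map from $\mathfrak g$ to $U_\top(\mathfrak g)$.
   Context: $\mathbb{K}$ is $\mathbb{R}$ or $\mathbb{C}$. A locality vector space is a vector space $V$ with a symmetric relation $\top\subset V\times V$ containing $(0,0)$ such that for every $U\subset V$ the polar set $U^\top=\{x: x\top u\ \forall u\in U\}$ is a linear subspace. A locality linear map is a linear map sending related pairs to related pairs. A subspace $W$ of $(V,\top)$ is locality compatible with $\top$ if for all $x,y,z\in V$, $w\in W$ with $x\top y$ and $(x+w)\top z$, there is $w'\in W$ with $(x+w')\top y$ and $(x+w')\top z$. $\mathbb{K}(X)$ is the free vector space on $X$. Tensor algebra of $(V,\top)$: for $k\ge1$, $V^{\times_\top k}=\{(x_1,\dots,x_k)\in V^k: x_i\top x_j\ \forall i\ne j\}$; $I_{{\rm mult},k}(V)\subset\mathbb{K}(V^k)$ is spanned by all $(\dots,a_i+b_i,\dots)-(\dots,a_i,\dots)-(\dots,b_i,\dots)$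 and $(\dots,cx_i,\dots)-c(\dots,x_i,\dots)$. $V^{\otimes_\top k}=\mathbb{K}(V^{\times_\top k})/(I_{{\rm mult},k}(V)\cap\mathbb{K}(V^{\times_\top k}))\subset V^{\otimes k}$, $V^{\otimes_\top0}=\mathbb{K}$, $\mathcal{T}_\top(V)=\bigoplus_kV^{\otimes_\top k}$. $F^n(V)=\mathbb{K}\cdot1\oplus\bigoplus_{k=1}^n\mathbb{K}(V^{\times_\top k})$, $I^n_{\rm mult}(V)=\bigoplus_{k=1}^nI_{{\rm mult},k}(V)$. Tuples $(x_i),(y_j)$ are $\top_\times^n$-related iff $x_i\top y_j$ for all $i,j$; $1$ is related to every basis element; two elements of $F^n(V)$ are related iff all basis elements with nonzero coefficient in the first are related to all those in the second. Elements of $\mathcal{T}_\top(V)$ are $\top_\otimes$-related iff for some $n$ they have related representatives in $F^n(V)$. The product is the tensor product restricted to $\top_\otimes$, with unit $\mathbb{K}=V^{\otimes_\top 0}$. A map on $A\times_\top A:=\top$ is $\top_\times$-bilinear if its linear extension to $\mathbb{K}(\top)$ vanishes on $I_{{\rm mult},2}(A)\cap\mathbb{K}(\top)$. A locality Lie algebra is a locality vector space $(\mathfrak g,\top)$ with an antisymmetric $\top_\times$-bilinear bracket $[\,,]:\top\to\mathfrak g$ which is locality (if $(a,b),(a',b')\in\top$, $a\top a'$ and $b\top b'$, then $[a,b]\top[a',b']$), maps $(U^\top\times U^\top)\cap\top$ into $U^\top$ for all $U\subset\mathfrak g$, and satisfies the Jacobi identity for pairwise independent triples. A (pre-)locality ideal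 of an algebra with partial product $m$ defined on $\top$ is a subspace $I$ with $m(I\times I^\top),m(I^\top\times I)\subset I$. $J_\top(\mathfrak g)$ is the (pre-)locality ideal of $\mathcal{T}_\top(\mathfrak g)$ generated by all $a\otimes b-b\otimes a-[a,b]$, $a\top b$; $U_\top(\mathfrak g)=\mathcal{T}_\top(\mathfrak g)/J_\top(\mathfrak g)$ with the induced product and unit; $x\top_Uy$ iff there are representatives $a\in x,b\in y$ with $a\top_\otimes b$; $\iota_{\mathfrak g}$ is the composition $\mathfrak g\to\mathcal{T}_\top(\mathfrak g)\to U_\top(\mathfrak g)$. The coproduct $\Delta:U_\top(\mathfrak g)\to U_\top(\mathfrak g)\otimes_\top U_\top(\mathfrak g)$ is the unique locality algebra morphism (locality linear, multiplicative on related pairs, unital; the product on the target being $(a\otimes b)(c\otimes d)=ac\otimes bd$ on independent elements) with $\Delta(\iota_{\mathfrak g}(x))=\iota_{\mathfrak g}(x)\otimes1+1\otimes\iota_{\mathfrak g}(x)$ for $x\in\mathfrak g$. An element $y$ is primitive if $\Delta y=y\otimes1+1\otimes y$.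
   Formalization: It is assumed that the induced product on U_⊤(g) is well defined and that the coproduct Δ exists; with the stated notion of ideal the product can fail to exist, e.g. for R^3 with orthogonality and zero bracket, where J_⊤(g) is only Λ^2. *)

(* Defs.v *)
From HB Require Import structures.
From mathcomp Require Import all_boot all_order all_algebra.
From mathcomp Require Import boolp reals complex.
From mathcomp Require Import finmap monalg.

Set Implicit Arguments.
Unset Strict Implicit.
Unset Printing Implicit Defensive.

Import GRing.Theory.
Local Open Scope ring_scope.
Local Open Scope quotient_scope.

(* Subsets and relations are boolean-valued ([{pred V}], [rel V]); in the
   classical setting of [boolp] these are all subsets and all relations. *)

(* MathComp has several isomorphic copies of the real numbers, so "K is R or C"
   is stated up to field isomorphism. *)
Definition real_or_complex (K : fieldType) : Prop :=
  exists R : realType,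
    (exists f : {rmorphism R -> K}, bijective f) \/
    (exists f : {rmorphism R[i] -> K}, bijective f).

Section LinearAlgebra.
Variables (K : fieldType) (V : lmodType K).

Definition lspan (S : V -> Prop) : {pred V} := fun x =>
  `[< forall W : {pred V}, submod_closed W -> (forall s, S s -> s \in W) ->
      x \in W >].

Lemma lspan_closed (S : V -> Prop) : submod_closed (lspan S).
Proof.
split=> [|c x y /asboolP hx /asboolP hy]; apply/asboolP=> W hW hS.
  by case: hW.
by case: (hW) => _; apply; [exact: hx | exact: hy].
Qed.

Section Quotient.
Variables (W : {pred V}) (hW : submod_closed W).

Definition quot_zmod_closed : zmod_closed W := GRing.submod_closedB hW.

Definition zmod_of_submod : zmodClosed V :=
  HB.pack W (GRing.isZmodClosed.Build V W quot_zmod_closed).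

Definition lquot : Type := Quotient.quot zmod_of_submod.
HB.instance Definition _ := GRing.Zmodule.on lquot.

Definition qproj (x : V) : lquot :=
  \pi_(Quotient.quot zmod_of_submod) x.
Definition qrepr (x : lquot) : V :=
  repr (x : Quotient.quot zmod_of_submod).

Lemma qreprK : cancel qrepr qproj.
Proof. exact: reprK. Qed.

Lemma qproj_eq x y : (qproj x == qproj y) = (x - y \in W).
Proof. by rewrite /qproj -Quotient.idealrBE. Qed.

Lemma qprojD : {morph qproj : x y / x + y}.
Proof. by move=> x y; rewrite /qproj raddfD. Qed.

Lemma qprojP (x : lquot) : exists v, x = qproj v.
Proof. by exists (qrepr x); rewrite qreprK. Qed.

Definition qscale (c : K) (x : lquot) : lquot := qproj (c *: qrepr x).

Lemma qscale_proj c v : qscale c (qproj v) = qproj (c *: v).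
Proof.
apply/eqP; rewrite qproj_eq -scalerBr.
have [_ hZ] := GRing.submod_closed_semi hW.
by apply: hZ; rewrite -qproj_eq qreprK.
Qed.

Fact qscaleA a b v : qscale a (qscale b v) = qscale (a * b) v.
Proof. by case: (qprojP v) => {}v ->; rewrite !qscale_proj scalerA. Qed.
Fact qscale1 : left_id 1 qscale.
Proof. by move=> v; case: (qprojP v) => {}v ->; rewrite qscale_proj scale1r. Qed.
Fact qscaleDr : right_distributive qscale +%R.
Proof.
move=> c x y; case: (qprojP x) => {}x ->; case: (qprojP y) => {}y ->.
by rewrite -qprojD !qscale_proj -qprojD scalerDr.
Qed.
Fact qscaleDl v : {morph qscale^~ v : a b / a + b}.
Proof.
by move=> a b; case: (qprojP v) => {}v ->; rewrite !qscale_proj -qprojD scalerDl.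
Qed.
HB.instance Definition _ := GRing.Zmodule_isLmodule.Build K lquot
  qscaleA qscale1 qscaleDr qscaleDl.

Fact qproj_is_linear : linear qproj.
Proof. by move=> c x y; rewrite qprojD -qscale_proj. Qed.
HB.instance Definition _ := GRing.isLinear.Build K V lquot _ qproj qproj_is_linear.

End Quotient.
End LinearAlgebra.

Section Relations.
Variables (K : fieldType) (V : lmodType K).
Implicit Types (top : rel V) (U W : {pred V}).

Definition polar top U : {pred V} := fun x => `[< forall u, u \in U -> top x u >].

Definition locality_vector_space top : Prop :=
  [/\ symmetric top, top 0 0 & forall U, submod_closed (polar top U)].

(* Compatibility of the subspace [W] of [A] with the restriction of [top] to
   the subspace [A]. *)
Definition locality_compatible (A : {pred V}) top W : Prop :=
  forall x y z w, x \in A -> y \in A -> z \in A -> w \in W ->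
    top x y -> top (x + w) z ->
    exists w', [/\ w' \in W, top (x + w') y & top (x + w') z].

End Relations.

Section Locality.
Variables (K : fieldType) (V : lmodType K).

(* Tuples are finite sequences: K(V^k) is the subspace of [{malg K[seq V]}]
   spanned by the sequences of size k. *)

(* The spanning family of I_{mult,k}(V), where k = size u + 1 + size v. *)
Variant mult_gen (k : nat) : {malg K[seq V]} -> Prop :=
| MultAdd u v (a b : V) of (size u + (size v).+1)%N = k :
    mult_gen k (<< u ++ (a + b) :: v >> - << u ++ a :: v >> - << u ++ b :: v >>)
| MultScale u v (c : K) (x : V) of (size u + (size v).+1)%N = k :
    mult_gen k (<< u ++ (c *: x) :: v >> - c *: << u ++ x :: v >>).

(* The direct sum of the I_{mult,k}(V) for k in N. *)
Definition Imult (N : pred nat) : {pred {malg K[seq V]}} :=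
  lspan (fun f => exists2 k, N k & mult_gen k f).

Section TensorAlgebra.
Variable top : rel V.

Definition indep (w : seq V) : bool :=
  `[< forall i j, (i < size w)%N -> (j < size w)%N -> i != j ->
      top w`_i w`_j >].

Definition iword : Type := {w : seq V | indep w}.
HB.instance Definition _ := Choice.on iword.

(* The direct sum of the K(V^{x_top k}), k >= 0; the empty word is the basis
   element 1 of degree 0. *)
Definition Floc : Type := {malg K[iword]}.
HB.instance Definition _ := GRing.Lmodule.on Floc.

Definition Fincl (f : Floc) : {malg K[seq V]} :=
  \sum_(w <- msupp f) f@_w *: << sval w >>.

Definition Fdeg (N : pred nat) : {pred Floc} :=
  fun f => all (fun w : iword => N (size (sval w))) (msupp f).

Definition Ffilt (n : nat) : {pred Floc} := Fdeg (leq^~ n).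

(* [word w] is the basis element w if w is independent, and 0 otherwise *)
Definition word (w : seq V) : Floc :=
  if insub w is Some u then << (u : iword) >> else 0.

Definition toptimes : rel Floc := fun f g =>
  `[< forall u v : iword, u \in msupp f -> v \in msupp g ->
      forall x y, x \in sval u -> y \in sval v -> top x y >].

(* Concatenation, extended bilinearly; used only for f and g related by
   [toptimes], in which case every concatenated word is independent. *)
Definition Fmul (f g : Floc) : Floc :=
  \sum_(u <- msupp f) \sum_(v <- msupp g)
    (f@_u * g@_v) *: word (sval u ++ sval v).

Definition Imult_loc (N : pred nat) : {pred Floc} :=
  fun f => (f \in Fdeg N) && (Fincl f \in Imult N).

Definition multT : {pred Floc} := fun f => Fincl f \in Imult predT.

Lemma Fincl_coef (f : Floc) (w : seq V) :
  (Fincl f)@_w = if insub w is Some u then f@_(u : iword) else 0.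
Proof.
rewrite /Fincl raddf_sum /=; case: insubP => [u hu <-|hw].
  rewrite (eq_bigr (fun v => if v == u then f@_u else 0)); last first.
    move=> v _; rewrite mcoeffZ mcoeffU val_eqE.
    by case: eqP => [->|_]; rewrite ?mulr1 ?mulr0.
  case: (boolP (u \in msupp f)) => hf.
    rewrite (big_fsetD1 u) //= eqxx big1_fset ?addr0 // => v.
    by rewrite in_fsetD1 => /andP[/negPf->].
  rewrite mcoeff_outdom // big1_seq // => v /andP[_ hv].
  by case: eqP => // e; move: hf; rewrite -e hv.
rewrite big1_seq // => v _; rewrite mcoeffZ mcoeffU.
by case: eqP => [e|]; rewrite ?mulr0 //; move: hw; rewrite -e (valP v).
Qed.

Lemma Fincl_is_linear : linear Fincl.
Proof.
move=> c f g; apply/malgP=> w; rewrite mcoeffD mcoeffZ !Fincl_coef.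
by case: insubP => [u _ _|_]; rewrite ?mcoeffD ?mcoeffZ ?mulr0 ?addr0.
Qed.
HB.instance Definition _ :=
  GRing.isLinear.Build K Floc {malg K[seq V]} _ Fincl Fincl_is_linear.

Lemma multT_closed : submod_closed multT.
Proof.
have [h0 hl] := lspan_closed (fun f => exists2 k, predT k & mult_gen k f).
split=> [|c f g hf hg]; first by rewrite unfold_in linear0.
by rewrite unfold_in linearP; apply: hl.
Qed.

(* T_top(V), the direct sum of the K(V^{x_top k}) / (I_{mult,k}(V) \cap
   K(V^{x_top k})) *)
Definition Tloc : Type := lquot multT_closed.
HB.instance Definition _ := GRing.Lmodule.on Tloc.

Definition Tproj : Floc -> Tloc := qproj multT_closed.

(* the direct summand of degree k of T_top(V) *)
Definition Tdeg (k : nat) : {pred Tloc} :=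
  fun t => `[< exists2 f, f \in Fdeg (pred1 k) & t = Tproj f >].

Definition topotimes : rel Tloc := fun s t =>
  `[< exists n f g, [/\ f \in Ffilt n, g \in Ffilt n,
        s = Tproj f, t = Tproj g & toptimes f g] >].

(* [Tprod s t r]: s and t are topotimes-related, and r is their product. *)
Definition Tprod (s t r : Tloc) : Prop :=
  exists n f g, [/\ f \in Ffilt n, g \in Ffilt n, toptimes f g &
    [/\ s = Tproj f, t = Tproj g & r = Tproj (Fmul f g)]].

Definition tens2 (a b : V) : Tloc := Tproj (word [:: a; b]).

(* t is the class of h in the full tensor algebra, which contains T_top(V) *)
Definition tensor_class (t : Tloc) (h : {malg K[seq V]}) : Prop :=
  exists2 f, t = Tproj f & Fincl f - h \in Imult predT.

(* [m] is only meaningful on pairs related by [top]. *)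
Definition toptimes_bilinear (W : lmodType K) (m : V -> V -> W) : Prop :=
  forall f, f \in Imult_loc (pred1 2) ->
    \sum_(w <- msupp f) f@_w *: m (sval w)`_0 (sval w)`_1 = 0.

Definition locality_ideal (I : {pred Tloc}) : Prop :=
  submod_closed I /\
  forall s t r, s \in I -> t \in polar topotimes I ->
    (Tprod s t r -> r \in I) /\ (Tprod t s r -> r \in I).

End TensorAlgebra.

(* The bracket is a function on pairs related by [top]; its values on the other
   pairs play no role. *)
Definition locality_lie_algebra top (br : V -> V -> V) : Prop :=
  locality_vector_space top /\
  [/\ toptimes_bilinear top br,
      forall a b, top a b -> br a b = - br b a,
      forall a b a' b', top a b -> top a' b' -> top a a' -> top b b' ->
        top (br a b) (br a' b'),
      forall U a b, a \in polar top U -> b \in polar top U -> top a b ->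
        br a b \in polar top U
    & forall a b c, top a b -> top b c -> top a c ->
        br a (br b c) + br b (br c a) + br c (br a b) = 0].

Section Enveloping.
Variables (top : rel V) (br : V -> V -> V).

Definition Jrel (t : Tloc top) : Prop :=
  exists a b, top a b /\
    t = tens2 top a b - tens2 top b a - Tproj (word top [:: br a b]).

Definition Jloc : {pred Tloc top} := fun t =>
  `[< forall I, locality_ideal I -> (forall s, Jrel s -> s \in I) -> t \in I >].

Lemma Jloc_closed : submod_closed Jloc.
Proof.
split=> [|c s t /asboolP hs /asboolP ht]; apply/asboolP=> I hI hr.
  by case: hI => -[].
by case: (hI) => -[_ hl] _; apply: hl; [exact: hs | exact: ht].
Qed.

Definition Uloc : Type := lquot Jloc_closed.
HB.instance Definition _ := GRing.Lmodule.on Uloc.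

Definition Uproj : Tloc top -> Uloc := qproj Jloc_closed.

Definition topU : rel Uloc := fun x y =>
  `[< exists s t, [/\ x = Uproj s, y = Uproj t & topotimes s t] >].

Definition Uone : Uloc := Uproj (Tproj (word top [::])).

Definition iota_lie (x : V) : Uloc := Uproj (Tproj (word top [:: x])).

(* [m] is only meaningful on pairs related by [topU]; such an [m] exists exactly
   when the product induced on the quotient is well defined. *)
Definition induced_product (m : Uloc -> Uloc -> Uloc) : Prop :=
  forall s t r, Tprod s t r -> m (Uproj s) (Uproj t) = Uproj r.

End Enveloping.
End Locality.

Arguments Ffilt {K V} top n.
Arguments Imult_loc {K V} top N.
Arguments toptimes {K V} top f g.
Arguments topotimes {K V} top s t.
Arguments Jloc {K V} top br t.
Arguments topU {K V} top br x y.

Section Coproduct.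
Variables (K : fieldType) (g : lmodType K) (top : rel g) (br : g -> g -> g).
Local Notation U := (Uloc top br).
Local Notation topUg := (topU top br).
Local Notation one := (Uone top br).
Local Notation "a ⊗ b" := (tens2 topUg a b) (at level 40).

(* The bilinear extension of ((a, b), (c, d)) |-> (a c, b d), with values in
   K(U^2). *)
Definition UUmul (m : U -> U -> U) (p q : Floc topUg) : {malg K[seq U]} :=
  \sum_(u <- msupp p) \sum_(v <- msupp q) (p@_u * q@_v) *:
    << [:: m (sval u)`_0 (sval v)`_0; m (sval u)`_1 (sval v)`_1] >>.

(* The target U (x)_top U is the degree-2 summand of T_top(U), and its product
   is computed in U (x) U. *)
Record is_coproduct (m : U -> U -> U) (D : {linear U -> Tloc topUg}) : Prop := {
  coproduct_deg2 : forall x, D x \in Tdeg 2;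
  coproduct_locality : forall x y, topUg x y -> topotimes topUg (D x) (D y);
  coproduct_mul : forall x y, topUg x y ->
    forall p q, p \in Fdeg (pred1 2) -> q \in Fdeg (pred1 2) ->
      toptimes topUg p q -> D x = Tproj p -> D y = Tproj q ->
      tensor_class (D (m x y)) (UUmul m p q);
  coproduct_one : D one = one ⊗ one;
  coproduct_iota : forall x : g,
    D (iota_lie top br x) =
      iota_lie top br x ⊗ one + one ⊗ iota_lie top br x
}.

Definition primitive_elt (D : U -> Tloc topUg) (y : U) : Prop :=
  D y = y ⊗ one + one ⊗ y.

End Coproduct.

(* Main.v *)
Require Import Defs.
From HB Require Import structures.
From mathcomp Require Import all_boot all_order all_algebra.
From mathcomp Require Import boolp classical_sets reals complex.
From mathcomp Require Import finmap monalg.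
Import GRing.Theory.
Local Open Scope ring_scope.

Set Implicit Arguments.
Unset Strict Implicit.
Unset Printing Implicit Defensive.

(** Work with all words in the letters of [g], modulo multilinearity; the words
    of pairwise independent letters span the tensor algebra of the statement.

    Symmetrization identifies the enveloping algebra with symmetric tensors. An
    ordered basis is of no use for proving this here, since expanding letters in a
    basis destroys independence. Instead, [n] times a word [w] of length [n] is
    congruent to the sum of the words obtained by moving one letter to the front,
    plus words of length [n - 1] in which two letters are replaced by their
    bracket; iterating gives [w = sym w + defect w], where [defect w] is an
    explicit combination of shorter words. Brackets of independent letters are
    independent of the remaining letters, so only brackets that exist occur. The
    Jacobi identity yields [defect_swap]: [defect] is compatible with the
    relations up to shorter relations. Hence straightening [w] into symmetrized
    words, [pbw], does not depend on choices and kills the relations ([env_pbw]);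
    it is multilinear because the partial bracket extends to a bilinear one
    ([bracket_extension]).

    The kernel of [pbw] is a locality ideal ([pbw_kernel_ideal]), so it contains
    the defining ideal. Conversely, words congruent under the relations have the
    same class ([ucls_env]), because the existence of the induced product forces
    the defining ideal to be stable under multiplication by independent words.
    Therefore [pbw] induces an injection [upbw] of the enveloping algebra into the
    tensor algebra ([upbw_inj]), whose values are symmetric.

    The coproduct of a word is the sum over its unshuffles ([Delta_word]), and that
    of a symmetrized word [sym w] is the sum of the products of symmetrized
    complementary subwords ([unshuffle_pairing_sym]). Multiply, in the tensor
    algebra, the part of degree at most one of the first factor with the second
    factor: the empty first subword gives [sym w], and the one-letter first
    subwords together give [size w] times [sym w]. So on symmetric tensors of
    degree [n] this operation is multiplication by [n + 1] ([tpairing_Delta]). On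
    a primitive element with symmetric representative [q] it gives [q] plus the
    part of [q] of degree at most one. Comparing degrees in characteristic zero,
    [q] is concentrated in degree one, where the tensor algebra is [g]. *)

(** * Linear algebra over arbitrary vector spaces *)

Section LinearSpan.
Variables (K : fieldType) (V : lmodType K).

Lemma mem_lspan (S : V -> Prop) s : S s -> s \in lspan S.
Proof. by move=> Ss; apply/asboolP => W _; apply. Qed.

Lemma lspan_ind (S : V -> Prop) (P : V -> Prop) :
  P 0 -> (forall c x y, P x -> P y -> P (c *: x + y)) ->
  (forall s, S s -> P s) -> forall x, x \in lspan S -> P x.
Proof.
move=> P0 Plin PS x /asboolP/(_ (fun y => `[< P y >])) xP; apply/asboolP/xP.
  by split=> [|c y z /asboolP Py /asboolP Pz]; apply/asboolP; [|exact: Plin].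
by move=> s /PS Ps; apply/asboolP.
Qed.

Lemma eq_qproj (W : {pred V}) (hW : submod_closed W) x y :
  qproj hW x = qproj hW y <-> x - y \in W.
Proof. by split=> [/eqP|xyW]; rewrite ?qproj_eq //; apply/eqP; rewrite qproj_eq. Qed.

Lemma qproj_eq0 (W : {pred V}) (hW : submod_closed W) x :
  qproj hW x = 0 <-> x \in W.
Proof. by rewrite -(linear0 (qproj hW)) eq_qproj subr0. Qed.

End LinearSpan.

Section LinearExtension.
Variables (K : fieldType) (F V W : lmodType K).
Variables (i : {linear F -> V}) (l : {linear F -> W}).
Hypothesis i0_l0 : forall f, i f = 0 -> l f = 0.

(** Partial linear maps are handled as graphs, so that a chain of extensions has
    its union as an upper bound. *)
Definition linear_graph (G : set (V * W)) : Prop :=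
  (forall c x y, G x -> G y -> G (c *: x + y)) /\
  (forall w, G (0, w) -> w = 0).

Let G0 : set (V * W) := [set x | exists f, x = (i f, l f)]%classic.

Lemma maximal_linear_graph : exists G : set (V * W), [/\ (G0 `<=` G)%classic,
  linear_graph G & forall H : set (V * W), (G `<=` H)%classic -> linear_graph H ->
    (H `<=` G)%classic].
Proof.
have G0g : linear_graph G0.
  split=> [c x y [f ->] [f' ->]|w [f [if0 ->]]].
    by exists (c *: f + f'); rewrite !linearP.
  exact/i0_l0.
have [C FC Ctot|G [Gg Gmax]] :=
    @Zorn_bigcup _ [set G | linear_graph (G0 `|` G)]%classic.
  split=> [c x y|w].
    have step A x' y' : (A = set0 \/ C A)%classic -> (G0 `|` A)%classic x' ->
        (G0 `|` A)%classic y' ->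
        (G0 `|` \bigcup_(X in C) X)%classic (c *: x' + y').
      case=> [->|CA] x'A y'A.
        by left; move: x'A y'A; rewrite classical_sets.setU0; apply: G0g.1.
      have [|] := (FC A CA).1 c _ _ x'A y'A; first by left.
      by move=> h; right; exists A.
    have inA z : (G0 `|` \bigcup_(X in C) X)%classic z ->
        exists A, (A = set0 \/ C A)%classic /\ (G0 `|` A)%classic z.
      by case=> [h|[A CA Az]]; [exists set0; split; left | exists A; split; right].
    move=> /inA[A [CA Ax]] /inA[B [CB By]].
    have [AB|BA] : (A `<=` B \/ B `<=` A)%classic.
      case: CA => [->|CA]; first by left; exact: classical_sets.sub0set.
      by case: CB => [->|CB]; [right; exact: classical_sets.sub0set | exact: Ctot].
    - by apply: (step B) => //; case: Ax => [h|/AB h]; [left|right].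
    - by apply: (step A) => //; case: By => [h|/BA h]; [left|right].
  case=> [|[A CA Aw]]; first exact: G0g.2.
  by apply: (FC A CA).2; right.
exists (G0 `|` G)%classic; split; [by move=> x; left | exact: Gg | ].
move=> H GH Hg; apply: contrapT => HG; apply: (Gmax H).
  split; first by move=> x Gx; apply: GH; right.
  by move=> HsubG; apply: HG => x /HsubG Gx; right.
rewrite /=; suff -> : (G0 `|` H = H)%classic by [].
by apply/classical_sets.setUidPr => x G0x; apply: GH; left.
Qed.

(** A maximal graph is defined at every [v]: otherwise its sum with the line
    spanned by [(v, 0)] would still be single-valued. *)
Lemma linear_extension : exists L : {linear V -> W}, forall f, L (i f) = l f.
Proof.
have [G [G0G [Glin Gfun] Gmax]] := maximal_linear_graph.
have total v : exists w, G (v, w).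
  pose H : set (V * W) := [set x | exists k y, G y /\ x = y + k *: (v, 0)]%classic.
  apply: contrapT => nv.
  have GH : (G `<=` H)%classic by move=> x Gx; exists 0, x; rewrite scale0r addr0.
  have Hg : linear_graph H.
    split=> [c x y [k [x' [Gx ->]]] [k' [y' [Gy ->]]]|w [k [[v' w'] [Gx]]]].
      exists (c * k + k'), (c *: x' + y'); split; first exact: Glin.
      by rewrite scalerDr scalerDl scalerA addrACA.
    case=> e ->; rewrite scaler0 addr0; have [k0|k0] := eqVneq k 0.
      by apply: Gfun; move: e Gx; rewrite k0 scale0r addr0 => <-.
    case: nv; exists (- k^-1 *: w').
    have -> : (v, - k^-1 *: w') = - k^-1 *: (v', w') + 0.
      rewrite addr0; congr pair; have -> : v' = - (k *: v).
        by apply/eqP; rewrite -addr_eq0 -e.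
      by rewrite /= scalerN scaleNr opprK scalerA mulVf // scale1r.
    by apply: Glin => //; apply: G0G; exists 0; rewrite !linear0.
  apply: nv; exists 0; apply: (Gmax H GH Hg); exists 1, 0; split.
    by apply: G0G; exists 0; rewrite !linear0.
  by rewrite scale1r add0r.
have Gw := fun v => cid (total v); pose L v := sval (Gw v).
have GL v : G (v, L v) by exact: svalP (Gw v).
have GLE v w : G (v, w) -> w = L v.
  move=> Gvw; apply/eqP; rewrite -subr_eq0; apply/eqP/Gfun.
  have := Glin (-1) _ _ (GL v) Gvw; rewrite !scaleN1r.
  by congr (G _); congr pair; rewrite /= ?addNr // addrC.
have Llin : linear L.
  by move=> c x y; apply/esym/GLE; exact: (Glin c _ _ (GL x) (GL y)).
pose LM := GRing.isLinear.Build K V W _ L Llin.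
exists (HB.pack L LM : {linear V -> W}) => f /=.
by apply/esym/GLE/G0G; exists f.
Qed.

End LinearExtension.

(** * Linear maps on spaces of formal combinations *)

HB.lock Definition linext (K : fieldType) (T : choiceType) (W : lmodType K)
  (F : T -> W) (f : {malg K[T]}) : W := \sum_(t <- msupp f) f@_t *: F t.
Canonical linext_unlockable := Unlockable linext.unlock.

Lemma malg_sumU (K : fieldType) (T : choiceType) (f : {malg K[T]}) :
  f = \sum_(t <- msupp f) f@_t *: << t >>.
Proof.
rewrite {1}[f]monalgE; apply: eq_bigr => t _; apply/malgP => u.
by rewrite mcoeffZ !mcoeffU mulrnAr mulr1.
Qed.

Section FreeModule.
Variables (K : fieldType) (T : choiceType) (W : lmodType K).

Lemma linextEw (F : T -> W) (A : {fset T}) (f : {malg K[T]}) :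
  (msupp f `<=` A)%fset -> linext F f = \sum_(t <- A) f@_t *: F t.
Proof.
move=> fA; rewrite unlock (big_fset_incl _ fA) // => t _ /mcoeff_outdom->.
by rewrite scale0r.
Qed.

Fact linext_is_linear (F : T -> W) : linear (linext F).
Proof.
move=> c f g; pose A := (msupp f `|` msupp g)%fset.
have fA : (msupp f `<=` A)%fset by apply: fsubsetUl.
have gA : (msupp g `<=` A)%fset by apply: fsubsetUr.
have hA : (msupp (c *: f + g)%R `<=` A)%fset.
  by apply: fsubset_trans (msuppD_le _ _) _; rewrite fsetSU // msuppZ_le.
rewrite !(linextEw _ (A := A)) // scaler_sumr -big_split /=.
by apply: eq_bigr => t _; rewrite mcoeffD mcoeffZ scalerDl scalerA.
Qed.
HB.instance Definition _ F :=
  GRing.isLinear.Build K {malg K[T]} W _ (linext F) (linext_is_linear F).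

Lemma linextU (F : T -> W) t : linext F << t >> = F t.
Proof.
by rewrite (linextEw _ (A := [fset t]%fset)) ?msuppU_le // big_seq_fset1
  mcoeffUU scale1r.
Qed.

Lemma eq_linext (F G : T -> W) : F =1 G -> linext F =1 linext G.
Proof. by move=> FG f; rewrite unlock; apply: eq_bigr => t _; rewrite FG. Qed.

Lemma linextD (F G : T -> W) f :
  linext (fun t => F t + G t) f = linext F f + linext G f.
Proof. by rewrite unlock -big_split; apply: eq_bigr => t _; rewrite scalerDr. Qed.

Lemma linextZ (c : K) (F : T -> W) f :
  linext (fun t => c *: F t) f = c *: linext F f.
Proof.
by rewrite unlock scaler_sumr; apply: eq_bigr => t _; rewrite !scalerA mulrC.
Qed.

End FreeModule.

Lemma linear_linext (K : fieldType) (T : choiceType) (W W' : lmodType K)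
  (L : {linear W -> W'}) (F : T -> W) (f : {malg K[T]}) :
  L (linext F f) = linext (fun t => L (F t)) f.
Proof.
by rewrite unlock linear_sum /=; apply: eq_bigr => t _; rewrite linearZ.
Qed.

Section Bilinear.
Variables (K : fieldType) (S T : choiceType) (W : lmodType K).
Implicit Types (f : {malg K[S]}) (h : {malg K[T]}) (F : S -> T -> W).

Definition bilext F f h : W := linext (fun s => linext (F s) h) f.

Lemma bilextC F f h : bilext F f h = linext (fun t => linext (F^~ t) f) h.
Proof.
rewrite /bilext unlock.
under eq_bigr do rewrite scaler_sumr.
rewrite exchange_big /=; apply: eq_bigr => t _; rewrite scaler_sumr.
by apply: eq_bigr => s _; rewrite !scalerA mulrC.
Qed.

Lemma bilextE F f h :
  bilext F f h = \sum_(s <- msupp f) \sum_(t <- msupp h) (f@_s * h@_t) *: F s t.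
Proof.
rewrite /bilext unlock; apply: eq_bigr => s _; rewrite scaler_sumr.
by apply: eq_bigr => t _; rewrite scalerA.
Qed.

Lemma bilextUU F s t : bilext F << s >> << t >> = F s t.
Proof. by rewrite /bilext !linextU. Qed.

Lemma bilextPl F c f f' h :
  bilext F (c *: f + f') h = c *: bilext F f h + bilext F f' h.
Proof. by rewrite /bilext linearP. Qed.

Lemma bilextPr F c f h h' :
  bilext F f (c *: h + h') = c *: bilext F f h + bilext F f h'.
Proof. by rewrite !bilextC linearP. Qed.

Lemma bilextZl F c f h : bilext F (c *: f) h = c *: bilext F f h.
Proof. by rewrite /bilext linearZ. Qed.

Lemma bilextZr F c f h : bilext F f (c *: h) = c *: bilext F f h.
Proof. by rewrite !bilextC linearZ. Qed.

Lemma bilextDl F f f' h : bilext F (f + f') h = bilext F f h + bilext F f' h.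
Proof. by rewrite /bilext linearD. Qed.

Lemma bilextBl F f f' h : bilext F (f - f') h = bilext F f h - bilext F f' h.
Proof. by rewrite /bilext linearB. Qed.

Lemma bilext_suml F (I : Type) (r : seq I) (f : I -> {malg K[S]}) h :
  bilext F (\sum_(i <- r) f i) h = \sum_(i <- r) bilext F (f i) h.
Proof. by rewrite /bilext linear_sum. Qed.

Lemma bilext_sumr F (I : Type) (r : seq I) f (h : I -> {malg K[T]}) :
  bilext F f (\sum_(i <- r) h i) = \sum_(i <- r) bilext F f (h i).
Proof. by rewrite bilextC linear_sum; apply: eq_bigr => i _; rewrite bilextC. Qed.

(** Used to identify bilinear maps built from operators on formal
    combinations, such as [lcons] or [pbw], with extensions from the basis. *)
Lemma bilext_unique F (B : {malg K[S]} -> {malg K[T]} -> W) :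
  (forall h, linear (B^~ h)) -> (forall f, linear (B f)) ->
  (forall s t, B << s >> << t >> = F s t) -> forall f h, bilext F f h = B f h.
Proof.
move=> Bl Br BF f h.
pose L : {linear _ -> _} := HB.pack (B^~ h) (GRing.isLinear.Build K _ W _ (B^~ h) (Bl h)).
have BfE : B f h = \sum_(s <- msupp f) f@_s *: B << s >> h.
  rewrite -[LHS]/(L f) {1}[f]malg_sumU linear_sum; apply: eq_bigr => s _.
  by rewrite linearZ.
rewrite BfE /bilext unlock; apply: eq_bigr => s _; congr (_ *: _).
pose L' : {linear _ -> _} :=
  HB.pack (B << s >>) (GRing.isLinear.Build K _ W _ (B << s >>) (Br << s >>)).
rewrite -[RHS]/(L' h) [in RHS](malg_sumU h) linear_sum; apply: eq_bigr => t _.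
by rewrite linearZ /= BF.
Qed.

End Bilinear.

Section Support.
Variables (K : fieldType) (T : choiceType).

Definition supported (P : T -> Prop) : {pred {malg K[T]}} :=
  lspan (fun f => exists2 t, P t & f = << t >>).

Lemma supported_closed P : submod_closed (supported P).
Proof. exact: lspan_closed. Qed.

Lemma supported0 P : 0 \in supported P.
Proof. by case: (supported_closed P). Qed.

Lemma supported_lin P c f h :
  f \in supported P -> h \in supported P -> c *: f + h \in supported P.
Proof. by case: (supported_closed P) => _ lin; exact: lin. Qed.

Lemma supportedZ P c f : f \in supported P -> c *: f \in supported P.
Proof. by move=> fP; rewrite -[_ *: _]addr0 supported_lin ?supported0. Qed.

Lemma supportedD P f h :
  f \in supported P -> h \in supported P -> f + h \in supported P.
Proof. by move=> fP hP; rewrite -[f]scale1r supported_lin. Qed.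

Lemma supportedB P f h :
  f \in supported P -> h \in supported P -> f - h \in supported P.
Proof. by move=> fP hP; rewrite supportedD // -scaleN1r supportedZ. Qed.

Lemma supported_sum P (I : eqType) (r : seq I) (F : I -> {malg K[T]}) :
  (forall i, i \in r -> F i \in supported P) ->
  \sum_(i <- r) F i \in supported P.
Proof.
move=> FP; rewrite big_seq; elim/big_ind: _ => //; first exact: supported0.
by move=> x y; exact: supportedD.
Qed.

Lemma supportedU (P : T -> Prop) t : P t -> << t >> \in supported P.
Proof. by move=> Pt; apply: mem_lspan; exists t. Qed.

Lemma supportedP (P : T -> Prop) f :
  (forall t, t \in msupp f -> P t) -> f \in supported P.
Proof.
move=> fP; rewrite [f]malg_sumU; apply: supported_sum => t /fP Pt.
by apply: supportedZ; exact: supportedU.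
Qed.

Lemma supported_ind (P : T -> Prop) (Q : {malg K[T]} -> Prop) :
  Q 0 -> (forall c f g, Q f -> Q g -> Q (c *: f + g)) ->
  (forall t, P t -> Q << t >>) -> forall f, f \in supported P -> Q f.
Proof.
by move=> Q0 Qlin QP; apply: lspan_ind => // f [t Pt ->]; exact: QP.
Qed.

Lemma sub_supported (P P' : T -> Prop) f :
  (forall t, P t -> P' t) -> f \in supported P -> f \in supported P'.
Proof.
move=> PP'; move: f; apply: supported_ind => [|c f h|t /PP' P't].
- exact: supported0.
- exact: supported_lin.
- exact: supportedU.
Qed.

Lemma mem_msuppU (s t : T) : s \in msupp (<< t >> : {malg K[T]}) -> s = t.
Proof. by move/(fsubsetP msuppU_le); rewrite inE => /eqP. Qed.

Lemma msupp_supported (P : T -> Prop) f t :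
  f \in supported P -> t \in msupp f -> P t.
Proof.
move=> fP; rewrite -mcoeff_neq0; move: f fP.
apply: supported_ind => [|c f h fP hP|u Pu].
- by rewrite mcoeff0 eqxx.
- rewrite mcoeffD mcoeffZ; have [f0|/fP//] := eqVneq f@_t 0.
  by rewrite f0 mulr0 add0r.
- by have [<-//|ut] := eqVneq u t; rewrite mcoeffU (negPf ut) mulr0n eqxx.
Qed.

Lemma eq_on_supported (W : lmodType K) (P : T -> Prop)
    (L L' : {linear {malg K[T]} -> W}) :
  (forall t, P t -> L << t >> = L' << t >>) ->
  forall f, f \in supported P -> L f = L' f.
Proof.
move=> PL; apply: supported_ind => [|c f h ef eh|//]; first by rewrite !linear0.
by rewrite !linearP ef eh.
Qed.

Lemma supported_all (f : {malg K[T]}) : f \in supported (fun=> True).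
Proof. exact: supportedP. Qed.

Lemma linear_malg_eq (W : lmodType K) (L L' : {linear {malg K[T]} -> W}) :
  (forall t, L << t >> = L' << t >>) -> L =1 L'.
Proof.
by move=> LL' f; apply: (@eq_on_supported _ (fun=> True)) => //; exact: supported_all.
Qed.

End Support.
Arguments supported_closed {K T} P.

(** * The full tensor algebra as a quotient of the formal words *)

Lemma Imult_closed (K : fieldType) (V : lmodType K) (N : pred nat) :
  submod_closed (@Imult K V N).
Proof. exact: lspan_closed. Qed.

Definition tensor (K : fieldType) (V : lmodType K) : lmodType K :=
  lquot (@Imult_closed K V predT).

HB.lock Definition tens (K : fieldType) (V : lmodType K) (f : {malg K[seq V]}) :
  tensor V := qproj (@Imult_closed K V predT) f.

HB.lock Definition lcons (K : fieldType) (V : lmodType K) (x : V)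
  (f : {malg K[seq V]}) : {malg K[seq V]} := linext (fun w => << x :: w >>) f.

Section Multilinear.
Variables (K : fieldType) (V : lmodType K).
Local Notation M := {malg K[seq V]}.

Fact tens_is_linear : linear (@tens K V).
Proof. by move=> c x y; rewrite tens.unlock linearP. Qed.
HB.instance Definition _ :=
  GRing.isLinear.Build K M (tensor V) _ (@tens K V) tens_is_linear.

Lemma tens_eq (f f' : M) : tens f = tens f' <-> f - f' \in Imult predT.
Proof. by rewrite tens.unlock; exact: eq_qproj. Qed.

Lemma tens_eq0 (f : M) : tens f = 0 <-> f \in Imult predT.
Proof. by rewrite tens.unlock; exact: qproj_eq0. Qed.

Lemma tens_surj (q : tensor V) : exists f : M, q = tens f.
Proof. by have [f ->] := qprojP q; exists f; rewrite tens.unlock. Qed.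

Lemma tensD (f f' : M) : tens (f + f') = tens f + tens f'.
Proof. exact: linearD. Qed.

Lemma tensB (f f' : M) : tens (f - f') = tens f - tens f'.
Proof. exact: linearB. Qed.

Lemma tens0 : tens (0 : M) = 0.
Proof. exact: linear0. Qed.

Lemma tensZ c (f : M) : tens (c *: f) = c *: tens f.
Proof. exact: linearZ. Qed.

Lemma tens_sum (I : Type) (r : seq I) (F : I -> M) :
  tens (\sum_(i <- r) F i) = \sum_(i <- r) tens (F i).
Proof. exact: linear_sum. Qed.

(** Additivity and homogeneity in each slot are merged into one equation; it
    gives the value zero on words with a zero letter by taking [c = 1]. *)
Definition multilinear (W : lmodType K) (F : seq V -> W) : Prop :=
  forall u v c x y,
    F (u ++ (c *: x + y) :: v) = c *: F (u ++ x :: v) + F (u ++ y :: v).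

Lemma qproj_multilinear (N : pred nat) u v c (x y : V) :
  N (size u + (size v).+1)%N ->
  qproj (@Imult_closed K V N) << u ++ (c *: x + y) :: v >> =
  c *: qproj (@Imult_closed K V N) << u ++ x :: v >> +
  qproj (@Imult_closed K V N) << u ++ y :: v >>.
Proof.
set k := (_ + _)%N => Nk.
have gen f : mult_gen k f -> qproj (@Imult_closed K V N) f = 0.
  by move=> kf; apply/qproj_eq0/mem_lspan; exists k.
have := gen _ (MultAdd (c *: x) y (erefl k)).
have := gen _ (MultScale c x (erefl k)).
rewrite !linearB /= linearZ => /subr0_eq<- /eqP.
by rewrite -addrA -opprD subr_eq0 => /eqP.
Qed.

Lemma tens_multilinear : multilinear (fun w => @tens K V << w >>).
Proof. by rewrite tens.unlock; move=> u v c x y; exact: qproj_multilinear. Qed.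

Section Closure.
Variable W : lmodType K.
Implicit Types F : seq V -> W.

Lemma linext_Imult (N : pred nat) F f :
  (forall u v c x y, N (size u + (size v).+1)%N ->
    F (u ++ (c *: x + y) :: v) = c *: F (u ++ x :: v) + F (u ++ y :: v)) ->
  f \in Imult N -> linext F f = 0.
Proof.
move=> Fmul; move: f; apply: lspan_ind => [|c f f' ef ef'|f [k Nk]].
- exact: linear0.
- by rewrite linearP /= ef ef' scaler0 addr0.
case=> [u v x y|u v c x] uvk; rewrite !linearB /= ?linearZ /= !linextU.
  have := Fmul u v 1 x y; rewrite !scale1r uvk => -> //.
  by rewrite addrAC addrK subrr.
have F0 : F (u ++ 0 :: v) = 0.
  have := Fmul u v 1 0 0; rewrite uvk !scale1r addr0 => /(_ Nk) e.
  by apply: (addrI (F (u ++ 0 :: v))); rewrite addr0 -e.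
by have := Fmul u v c x 0; rewrite uvk F0 !addr0 scalerN => -> //; rewrite subrr.
Qed.

Lemma linext_tens F f f' :
  multilinear F -> tens f = tens f' -> linext F f = linext F f'.
Proof.
move=> Fmul /tens_eq ff'; apply/eqP; rewrite -subr_eq0 -linearB.
by apply/eqP/(linext_Imult (N := predT)).
Qed.

Lemma multilinear_cons F :
  (forall w, linear (fun x => F (x :: w))) ->
  (forall x, multilinear (fun w => F (x :: w))) -> multilinear F.
Proof. by move=> F1 F2 [|z u] v c x y; [exact: F1 | exact: F2]. Qed.

Lemma eq_multilinear F G : F =1 G -> multilinear F -> multilinear G.
Proof. by move=> FG Fm u v c x y; rewrite -!FG. Qed.

Lemma multilinear_lin F G :
  multilinear F -> multilinear G -> multilinear (fun w => F w + G w).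
Proof. by move=> Fm Gm u v c x y; rewrite Fm Gm scalerDr addrACA. Qed.

Lemma multilinear_scale k F : multilinear F -> multilinear (fun w => k *: F w).
Proof.
by move=> Fm u v c x y; rewrite Fm scalerDr !scalerA mulrC.
Qed.

(** Substituting a map that is multilinear modulo [Imult] into a multilinear one;
    this is how every operator defined by recursion on words descends to the
    tensor algebra. *)
Lemma multilinear_comp F (G : seq V -> M) :
  multilinear F -> multilinear (fun w => tens (G w)) ->
  multilinear (fun w => linext F (G w)).
Proof.
move=> Fm Gm u v c x y; rewrite -linearP; apply: linext_tens => //.
by rewrite linearP; exact: Gm.
Qed.

End Closure.

(** ** Concatenation *)

Definition cat_malg (f h : M) : M :=
  bilext (fun u v => << u ++ v >>) f h.

Lemma cat_malgUU u v : cat_malg << u >> << v >> = << u ++ v >>.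
Proof. exact: bilextUU. Qed.

Lemma cat_malgC f h :
  cat_malg f h = linext (fun v => linext (fun u => << u ++ v >>) f) h.
Proof. exact: bilextC. Qed.

Fact cat_malg_is_linear f : linear (cat_malg f).
Proof. by move=> c x y; exact: bilextPr. Qed.
HB.instance Definition _ f :=
  GRing.isLinear.Build K M M _ (cat_malg f) (cat_malg_is_linear f).

Lemma cat_malgPl c f f' h :
  cat_malg (c *: f + f') h = c *: cat_malg f h + cat_malg f' h.
Proof. exact: bilextPl. Qed.

Lemma cat_malg0l h : cat_malg 0 h = 0.
Proof. by rewrite /cat_malg /bilext linear0. Qed.

Lemma cat_malg0s f : cat_malg << [::] >> f = f.
Proof.
rewrite /cat_malg /bilext linextU; apply: (linear_malg_eq (L' := idfun)) => w /=.
by rewrite linextU.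
Qed.

Lemma cat_malgs0 f : cat_malg f << [::] >> = f.
Proof.
rewrite cat_malgC linextU; apply: (linear_malg_eq (L' := idfun)) => w /=.
by rewrite linextU cats0.
Qed.

Lemma tens_cat f f' h h' : tens f = tens f' -> tens h = tens h' ->
  tens (cat_malg f h) = tens (cat_malg f' h').
Proof.
move=> ff' hh'; transitivity (tens (cat_malg f' h)).
  rewrite /cat_malg /bilext !linear_linext; apply: linext_tens => //.
  move=> u v c x y; rewrite !(linear_linext (@tens K V)) -linextZ -linextD.
  apply: eq_linext => w /=.
  by rewrite -!catA !cat_cons tens_multilinear.
rewrite !cat_malgC !linear_linext; apply: linext_tens => //.
move=> u v c x y; rewrite !(linear_linext (@tens K V)) -linextZ -linextD.
apply: eq_linext => w /=.
by rewrite !catA tens_multilinear.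
Qed.

Lemma lconsE x (f : M) : lcons x f = linext (fun w => << x :: w >>) f.
Proof. by rewrite lcons.unlock. Qed.

Fact lcons_is_linear x : linear (lcons x : M -> M).
Proof. by move=> c f h; rewrite !lconsE linearP. Qed.
HB.instance Definition _ x :=
  GRing.isLinear.Build K M M _ (lcons x : M -> M) (lcons_is_linear x).

Lemma lconsU x w : lcons x << w >> = << x :: w >> :> M.
Proof. by rewrite lconsE linextU. Qed.

Lemma cat_malg1 x (f : M) : cat_malg << [:: x] >> f = lcons x f.
Proof. by rewrite /cat_malg /bilext linextU lconsE. Qed.

Lemma lcons0 x : lcons x (0 : M) = 0.
Proof. exact: linear0. Qed.

Lemma lconsP x (c : K) (f h : M) : lcons x (c *: f + h) = c *: lcons x f + lcons x h.
Proof. exact: linearP. Qed.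

Lemma lconsD x (f h : M) : lcons x (f + h) = lcons x f + lcons x h.
Proof. exact: linearD. Qed.

Lemma lconsZ x (c : K) (f : M) : lcons x (c *: f) = c *: lcons x f.
Proof. exact: linearZ. Qed.

Lemma lcons_sum x (I : Type) (r : seq I) (F : I -> M) :
  lcons x (\sum_(i <- r) F i) = \sum_(i <- r) lcons x (F i).
Proof. exact: linear_sum. Qed.

Lemma tens_lcons x (f f' : M) : tens f = tens f' -> tens (lcons x f) = tens (lcons x f').
Proof. by move=> e; rewrite -!cat_malg1; exact: tens_cat. Qed.

Lemma tens_lcons0 x (f : M) : tens f = 0 -> tens (lcons x f) = 0.
Proof.
by rewrite -tens0 => /(tens_lcons x)->; rewrite linear0.
Qed.

Lemma multilinear_lcons x (F : seq V -> M) :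
  multilinear (fun w => tens (F w)) -> multilinear (fun w => tens (lcons x (F w))).
Proof.
move=> Fm u v c y z; rewrite -tensZ -tensD -linearP; apply: tens_lcons.
by rewrite tensD tensZ; exact: Fm.
Qed.

Lemma tens_lcons_linear (f : M) : linear (fun x => tens (lcons x f)).
Proof.
move=> c x y; have e z : tens (lcons z f) = linext (fun w => tens << z :: w >>) f.
  by rewrite lconsE; exact: (linear_linext (@tens K V)).
rewrite !e -linextZ -linextD; apply: eq_linext => w.
exact: (tens_multilinear [::]).
Qed.

End Multilinear.

(** * Splitting words *)

Section Picks.
Variable T : eqType.

(** One entry for each position, so that repeated letters count with multiplicity. *)
Fixpoint picks (w : seq T) : seq (T * seq T) :=
  if w is x :: w' then (x, w') :: [seq (p.1, x :: p.2) | p <- picks w'] else [::].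

Lemma picks_perm w p : p \in picks w -> perm_eq (p.1 :: p.2) w.
Proof.
elim: w p => //= x w IHw p; rewrite inE => /predU1P[->|]; first exact: perm_refl.
case/mapP => q /IHw qw ->; rewrite -(perm_cons x) in qw.
by apply: perm_trans qw; rewrite -(perm_catCA [:: x] [:: q.1]).
Qed.

Lemma size_picks w p : p \in picks w -> size w = (size p.2).+1.
Proof. by move/picks_perm/perm_size. Qed.

Lemma picks_perm_catl (s w : seq T) p :
  p \in picks w -> perm_eq (s ++ w) (p.1 :: s ++ p.2).
Proof.
move=> /picks_perm pw; rewrite perm_sym -cat1s perm_catCA perm_cat2l.
exact: pw.
Qed.

Lemma picks_perm_catr (s w : seq T) p :
  p \in picks w -> perm_eq (w ++ s) (p.1 :: p.2 ++ s).
Proof.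
by move=> /picks_perm; rewrite perm_sym -cat_cons => pw; rewrite perm_cat2r.
Qed.

Section Sums.
Variable W : nmodType.
Implicit Types F : T * seq T -> W.

Lemma sum_picks_cons F x w : \sum_(p <- picks (x :: w)) F p =
  F (x, w) + \sum_(p <- picks w) F (p.1, x :: p.2).
Proof. by rewrite /= big_cons big_map. Qed.

Lemma sum_picks_cat F u v : \sum_(p <- picks (u ++ v)) F p =
  \sum_(p <- picks u) F (p.1, p.2 ++ v) + \sum_(p <- picks v) F (p.1, u ++ p.2).
Proof.
elim: u F => [|x u IHu] F.
  by rewrite big_nil add0r; apply: eq_bigr => -[].
by rewrite cat_cons !sum_picks_cons IHu addrA.
Qed.

End Sums.
End Picks.

Lemma multilinear_picks (K : fieldType) (V W : lmodType K) (F : seq V -> W) :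
  multilinear F -> multilinear (fun w => \sum_(p <- picks w) F (p.1 :: p.2)).
Proof.
move=> Fm u v c x y.
have F1 z := Fm [::] z c x y.
have e z : \sum_(p <- picks (u ++ z :: v)) F (p.1 :: p.2) =
    \sum_(p <- picks u) F ((p.1 :: p.2) ++ z :: v) + F ([::] ++ z :: (u ++ v)) +
    \sum_(p <- picks v) F (p.1 :: u ++ z :: p.2).
  by rewrite sum_picks_cat sum_picks_cons addrA.
rewrite !e F1 (eq_bigr _ (fun p _ => Fm (p.1 :: p.2) v c x y)).
rewrite (eq_bigr _ (fun p _ => Fm (p.1 :: u) p.2 c x y)) !big_split /=.
rewrite -!scaler_sumr !scalerDr [RHS]addrACA; congr (_ + _).
by rewrite [RHS]addrACA.
Qed.

(** * Grading and product of the tensor algebra *)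

Section Degrees.
Variables (K : fieldType) (V : lmodType K).
Local Notation M := {malg K[seq V]}.

Definition deg_scale (d : nat -> K) : M -> M :=
  linext (fun w => d (size w) *: << w >>).
HB.instance Definition _ d := GRing.Linear.on (deg_scale d).

Lemma deg_scaleU d w : deg_scale d << w >> = d (size w) *: << w >>.
Proof. exact: linextU. Qed.

Lemma tens_deg_scale d f f' :
  tens f = tens f' -> tens (deg_scale d f) = tens (deg_scale d f').
Proof.
rewrite /deg_scale !(linear_linext (@tens K V)); apply: linext_tens.
move=> u v c x y; rewrite /= !tensZ !size_cat /= tens_multilinear scalerDr.
by rewrite !scalerA mulrC.
Qed.

Lemma deg_scale_comp d e f :
  deg_scale d (deg_scale e f) = deg_scale (fun n => e n * d n) f.
Proof.
pose L := deg_scale d \o deg_scale e.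
apply: (linear_malg_eq (L := L) _ f) => w.
by rewrite /L /= !deg_scaleU linearZ /= deg_scaleU scalerA.
Qed.

Lemma deg_scaleD d e f :
  deg_scale (fun n => d n + e n) f = deg_scale d f + deg_scale e f.
Proof.
by rewrite /deg_scale -linextD; apply: eq_linext => w; rewrite scalerDl.
Qed.

Lemma deg_scale1 f : deg_scale (fun=> 1) f = f.
Proof.
apply: (linear_malg_eq (L := deg_scale (fun=> 1)) (L' := idfun)) => w.
by rewrite /= deg_scaleU scale1r.
Qed.

(** In degree one the tensor algebra is [V]. *)
Lemma deg_scale_one f :
  exists x, tens (deg_scale (fun n => (n == 1)%:R) f) = tens << [:: x] >>.
Proof.
have lin1 c x y := @tens_multilinear K V [::] [::] c x y.
have zero : tens 0 = tens << [:: 0] >> :> tensor V.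
  have := lin1 0 0 0; rewrite !scale0r !add0r tens0 => /eqP.
  by have := lin1 1 0 0; rewrite !scale1r addr0 -[X in X = _]addr0 => /addrI.
move: f (supported_all f); apply: supported_ind => [|c f h [x ex] [y ey]|w _].
- by exists 0; rewrite linear0.
- by exists (c *: x + y); rewrite linearP tensD tensZ ex ey (lin1 c x y).
- rewrite deg_scaleU; case: w => [|x [|y w]] /=; last 2 first.
  + by exists x; rewrite scale1r.
  + by exists 0; rewrite scale0r.
  + by exists 0; rewrite scale0r.
Qed.

End Degrees.

Section TensorOperations.
Variables (K : fieldType) (V : lmodType K).
Local Notation M := {malg K[seq V]}.

Definition trep (q : tensor V) : M := sval (cid (tens_surj q)).

Lemma trepK : cancel trep (@tens K V).
Proof. by move=> q; rewrite /trep; case: cid. Qed.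

Definition tscale d (q : tensor V) : tensor V := tens (deg_scale d (trep q)).

Lemma tscaleE d f : tscale d (tens f) = tens (deg_scale d f).
Proof. by apply: tens_deg_scale; rewrite trepK. Qed.

Fact tscale_is_linear d : linear (tscale d).
Proof.
move=> c q r; rewrite -[q]trepK -[r]trepK -tensZ -tensD !tscaleE.
by rewrite [deg_scale _ _]linearP tensD tensZ.
Qed.
HB.instance Definition _ d :=
  GRing.isLinear.Build K (tensor V) (tensor V) _ (tscale d) (tscale_is_linear d).

Definition tmul (q r : tensor V) : tensor V := tens (cat_malg (trep q) (trep r)).

Lemma tmulE f h : tmul (tens f) (tens h) = tens (cat_malg f h).
Proof. by apply: tens_cat; rewrite trepK. Qed.

Lemma tmulPl c q q' r : tmul (c *: q + q') r = c *: tmul q r + tmul q' r.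
Proof.
rewrite -[q]trepK -[q']trepK -[r]trepK -tensZ -tensD !tmulE.
by rewrite cat_malgPl tensD tensZ.
Qed.

Lemma tmulPr c q r r' : tmul q (c *: r + r') = c *: tmul q r + tmul q r'.
Proof.
rewrite -[q]trepK -[r]trepK -[r']trepK -tensZ -tensD !tmulE.
by rewrite [cat_malg _ _]linearP tensD tensZ.
Qed.

Lemma tmul1l q : tmul (tens << [::] >>) q = q.
Proof. by rewrite -[q]trepK tmulE cat_malg0s. Qed.

Lemma tmul1r q : tmul q (tens << [::] >>) = q.
Proof. by rewrite -[q]trepK tmulE cat_malgs0. Qed.

End TensorOperations.

Section Pairing.
Variables (K : fieldType) (V W : lmodType K) (B : V -> V -> W).
Hypothesis Bl : forall y, linear (B^~ y).
Hypothesis Br : forall x, linear (B x).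

(** The linear map on the tensor algebra of [V] induced by the bilinear map [B]
    on the component of degree two, and by zero elsewhere. *)
Definition pairing : {malg K[seq V]} -> W :=
  linext (fun s => if s is [:: x; y] then B x y else 0).
HB.instance Definition _ := GRing.Linear.on pairing.

Lemma pairingU x y : pairing << [:: x; y] >> = B x y.
Proof. exact: linextU. Qed.

Lemma pairing_tens f f' : tens f = tens f' -> pairing f = pairing f'.
Proof.
apply: linext_tens => -[|z [|z' u]] v c x y /=.
- by case: v => [|t [|t' v]]; rewrite ?scaler0 ?addr0 //; exact: Bl.
- by case: v => [|t v]; rewrite ?scaler0 ?addr0 //; exact: Br.
- by case: u => [|t u]; rewrite /= scaler0 addr0.
Qed.

End Pairing.

(** * Unshuffles *)

Section Unshuffles.
Variable T : eqType.
Implicit Types (w : seq T) (p : seq T * seq T) (q : T * seq T).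

(** One entry for each set of positions: the terms of the unshuffling coproduct. *)
Fixpoint unshuffles w : seq (seq T * seq T) :=
  if w is x :: w' then
    [seq (x :: p.1, p.2) | p <- unshuffles w'] ++
    [seq (p.1, x :: p.2) | p <- unshuffles w']
  else [:: ([::], [::])].

Lemma unshuffles_perm w p : p \in unshuffles w -> perm_eq (p.1 ++ p.2) w.
Proof.
elim: w p => [|x w IHw] p /=; first by rewrite inE => /eqP->.
rewrite mem_cat => /orP[] /mapP[q /IHw qw ->] /=; first by rewrite perm_cons.
by rewrite -(cat1s x q.2) perm_catCA /= perm_cons.
Qed.

Lemma size_unshuffles w p : p \in unshuffles w -> (size p.1 + size p.2)%N = size w.
Proof. by move/unshuffles_perm/perm_size; rewrite size_cat. Qed.

Lemma sum_unshuffles_cons (W : nmodType) (F : seq T * seq T -> W) x w :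
  \sum_(p <- unshuffles (x :: w)) F p =
  \sum_(p <- unshuffles w) (F (x :: p.1, p.2) + F (p.1, x :: p.2)).
Proof. by rewrite /= big_cat !big_map big_split. Qed.

(** Both sides choose a letter of [w] and distribute the others over two
    subwords; the chosen letter is put in the first one. *)
Lemma sum_unshuffles_picksl (W : nmodType) (G : T -> seq T -> seq T -> W) w :
  \sum_(q <- picks w) \sum_(p <- unshuffles q.2) G q.1 p.1 p.2 =
  \sum_(p <- unshuffles w) \sum_(q <- picks p.1) G q.1 q.2 p.2.
Proof.
elim: w G => [|x w IHw] G; first by rewrite big_seq1 !big_nil.
have e : \sum_(q <- picks w) \sum_(p <- unshuffles (x :: q.2)) G q.1 p.1 p.2 =
    \sum_(q <- picks w) \sum_(p <- unshuffles q.2) G q.1 (x :: p.1) p.2 +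
    \sum_(q <- picks w) \sum_(p <- unshuffles q.2) G q.1 p.1 (x :: p.2).
  rewrite -big_split; apply: eq_bigr => q _.
  by rewrite sum_unshuffles_cons big_split.
rewrite sum_picks_cons sum_unshuffles_cons e (IHw (fun y u v => G y (x :: u) v)).
rewrite (IHw (fun y u v => G y u (x :: v))) addrA -!big_split /=.
by apply: eq_bigr => p _; rewrite big_cons big_map.
Qed.

(** The companion of [sum_unshuffles_picksl] where the chosen letter goes to the
    second subword. *)
Lemma sum_unshuffles_picksr (W : nmodType) (G : T -> seq T -> seq T -> W) w :
  \sum_(q <- picks w) \sum_(p <- unshuffles q.2) G q.1 p.1 p.2 =
  \sum_(p <- unshuffles w) \sum_(q <- picks p.2) G q.1 p.1 q.2.
Proof.
elim: w G => [|x w IHw] G; first by rewrite big_seq1 !big_nil.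
have e : \sum_(q <- picks w) \sum_(p <- unshuffles (x :: q.2)) G q.1 p.1 p.2 =
    \sum_(q <- picks w) \sum_(p <- unshuffles q.2) G q.1 (x :: p.1) p.2 +
    \sum_(q <- picks w) \sum_(p <- unshuffles q.2) G q.1 p.1 (x :: p.2).
  rewrite -big_split; apply: eq_bigr => q _.
  by rewrite sum_unshuffles_cons big_split.
rewrite sum_picks_cons sum_unshuffles_cons e (IHw (fun y u v => G y (x :: u) v)).
rewrite (IHw (fun y u v => G y u (x :: v))) addrCA -!big_split /=.
by apply: eq_bigr => p _; rewrite big_cons big_map.
Qed.

(** The first subword is empty once, and reduced to one letter once for each
    position of [w]. *)
Lemma sum_unshuffles_le1 (K : pzRingType) (W : lmodType K)
    (F : seq T -> seq T -> W) w :
  \sum_(p <- unshuffles w) (size p.1 <= 1)%:R *: F p.1 p.2 =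
  F [::] w + \sum_(q <- picks w) F [:: q.1] q.2.
Proof.
have sum0 (G : seq T -> seq T -> W) v :
    \sum_(p <- unshuffles v) (size p.1 == 0)%:R *: G p.1 p.2 = G [::] v.
  elim: v G => [|x v IHv] G; first by rewrite big_seq1 scale1r.
  rewrite sum_unshuffles_cons -[RHS](IHv (fun u v => G u (x :: v))).
  by apply: eq_bigr => p _; rewrite scale0r add0r.
elim: w F => [|x w IHw] F; first by rewrite big_seq1 big_nil scale1r addr0.
rewrite sum_unshuffles_cons big_split sum_picks_cons addrCA /=; congr (_ + _).
  by rewrite -[RHS](sum0 (fun u v => F (x :: u) v)); apply: eq_bigr => p _; case: p.1.
exact: (IHw (fun u v => F u (x :: v))).
Qed.

End Unshuffles.

(** * Symmetrization *)

Section Symmetrization.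
Variables (K : fieldType) (V : lmodType K).
Hypothesis char0 : forall n, n.+1%:R != 0 :> K.
Local Notation M := {malg K[seq V]}.
Implicit Types (u v w : seq V) (p : V * seq V).

Fixpoint sym_rec n w : M :=
  if n is m.+1 then n%:R^-1 *: \sum_(p <- picks w) lcons p.1 (sym_rec m p.2)
  else << w >>.

(** The average of [w] over all permutations of its positions; the recursion
    averages over the letter that comes first. *)
Definition sym w : M := sym_rec (size w) w.

Lemma sym_picks w :
  (size w)%:R *: sym w = \sum_(p <- picks w) lcons p.1 (sym p.2).
Proof.
case: w => [|x w]; first by rewrite scale0r big_nil.
rewrite /sym [size _]/= /sym_rec -/sym_rec scalerA mulfV // scale1r.
by apply: eq_big_seq => p /size_picks[<-].
Qed.

Lemma sym_nil : sym [::] = << [::] >>.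
Proof. by []. Qed.

Lemma sym1 x : sym [:: x] = << [:: x] >>.
Proof. by have := sym_picks [:: x]; rewrite scale1r big_seq1 sym_nil lconsU. Qed.

Lemma sym_rec_multilinear n : multilinear (fun w => tens (sym_rec n w)).
Proof.
elim: n => [|n IHn] /=; first exact: tens_multilinear.
pose F w := if w is x :: w' then tens (lcons x (sym_rec n w')) else 0.
have Fm : multilinear F.
  apply: multilinear_cons => [w|x] /=; first exact: tens_lcons_linear.
  exact: multilinear_lcons.
apply: eq_multilinear (multilinear_scale _ (multilinear_picks Fm)) => w /=.
by rewrite tensZ tens_sum.
Qed.

(** The average over the first letter is insensitive to the order of two adjacent
    letters: when neither comes first, one concludes by induction; when one of
    them comes first, the remaining words are equal. *)
Lemma sym_swap u a b v : sym (u ++ a :: b :: v) = sym (u ++ b :: a :: v).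
Proof.
have [n] := ubnP (size u + size v); elim: n u v => // n IHn u v; rewrite ltnS => le_n.
have sz (x y : V) : size (u ++ x :: y :: v) = (size u + size v).+2.
  by rewrite size_cat /= !addnS.
apply: (scalerI (char0 (size u + size v).+1)).
rewrite -{1}(sz a b) -(sz b a) !sym_picks !sum_picks_cat !sum_picks_cons /=.
congr (_ + _).
  rewrite big_seq [RHS]big_seq; apply: eq_bigr => p /size_picks szp.
  by rewrite IHn //; move: le_n; rewrite szp addSn.
rewrite addrCA; congr (_ + (_ + _)).
rewrite big_seq [RHS]big_seq; apply: eq_bigr => p /size_picks szp.
by rewrite IHn //; move: le_n; rewrite szp addnS.
Qed.

End Symmetrization.

Section CoproductOfSymmetrization.
Variables (K : fieldType) (V : lmodType K).
Hypothesis char0 : forall n, n.+1%:R != 0 :> K.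
Local Notation M := {malg K[seq V]}.

Lemma bilext_lconsl (W : lmodType K) (G : seq V -> seq V -> W) x f h :
  bilext G (lcons x f) h = bilext (fun u v => G (x :: u) v) f h.
Proof.
apply/esym/(bilext_unique (B := fun f h => bilext G (lcons x f) h)).
- by move=> h' c a d; rewrite lconsP bilextPl.
- by move=> f' c a d; rewrite bilextPr.
- by move=> s t; rewrite lconsU bilextUU.
Qed.

Lemma bilext_lconsr (W : lmodType K) (G : seq V -> seq V -> W) x f h :
  bilext G f (lcons x h) = bilext (fun u v => G u (x :: v)) f h.
Proof.
apply/esym/(bilext_unique (B := fun f h => bilext G f (lcons x h))).
- by move=> h' c a d; rewrite bilextPl.
- by move=> f' c a d; rewrite lconsP bilextPr.
- by move=> s t; rewrite lconsU bilextUU.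
Qed.

(** The unshuffling coproduct, paired with a bilinear map given by its values
    [G] on words. *)
Definition unshuffle_pairing (W : lmodType K) (G : seq V -> seq V -> W) : M -> W :=
  linext (fun w => \sum_(p <- unshuffles w) G p.1 p.2).
HB.instance Definition _ (W : lmodType K) (G : seq V -> seq V -> W) :=
  GRing.Linear.on (unshuffle_pairing G).

Lemma unshuffle_pairing_lcons (W : lmodType K) (G : seq V -> seq V -> W) x f :
  unshuffle_pairing G (lcons x f) =
  unshuffle_pairing (fun u v => G (x :: u) v) f +
  unshuffle_pairing (fun u v => G u (x :: v)) f.
Proof.
rewrite /unshuffle_pairing -linextD.
pose L1 := linext (fun w => \sum_(p <- unshuffles w) G p.1 p.2) \o @lcons K V x.
apply: (linear_malg_eq (L := L1) _ f) => w.
by rewrite /= lconsU !linextU sum_unshuffles_cons big_split.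
Qed.

(** Averaging over the first letter commutes with unshuffling, since that letter
    opens one of the two subwords: the coproduct of a symmetrized word is the sum
    of the products of symmetrized complementary subwords. *)
Lemma unshuffle_pairing_sym (W : lmodType K) (G : seq V -> seq V -> W) w :
  unshuffle_pairing G (sym w) =
  \sum_(p <- unshuffles w) bilext G (sym p.1) (sym p.2).
Proof.
have [n] := ubnP (size w); elim: n w G => // n IHn [|x w] G; rewrite ltnS => szw.
  by rewrite /unshuffle_pairing !sym_nil linextU !big_seq1 bilextUU.
apply: (scalerI (char0 (size w))); rewrite -[(size w).+1]/(size (x :: w)).
move: (x :: w) szw => {x}w szw.
rewrite -linearZ sym_picks // linear_sum scaler_sumr.
transitivity (\sum_(q <- picks w) \sum_(p <- unshuffles q.2)
  (bilext G (lcons q.1 (sym p.1)) (sym p.2) +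
   bilext G (sym p.1) (lcons q.1 (sym p.2)))).
  rewrite big_seq [RHS]big_seq; apply: eq_bigr => q qw.
  have szq : (size q.2 < n)%N by rewrite -(size_picks qw).
  rewrite /= unshuffle_pairing_lcons !IHn // -big_split; apply: eq_bigr => p _ /=.
  by rewrite bilext_lconsl bilext_lconsr.
under eq_bigr do rewrite big_split.
rewrite big_split /=.
rewrite (sum_unshuffles_picksl (fun y u v => bilext G (lcons y (sym u)) (sym v))).
rewrite (sum_unshuffles_picksr (fun y u v => bilext G (sym u) (lcons y (sym v)))).
rewrite -big_split /= big_seq [RHS]big_seq; apply: eq_bigr => p pw.
rewrite -bilext_suml -bilext_sumr -!sym_picks // bilextZl bilextZr.
by rewrite -scalerDl -natrD (size_unshuffles pw).
Qed.

End CoproductOfSymmetrization.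

(** * The straightening operators *)

Section Straightening.
Variables (K : fieldType) (V : lmodType K).
Hypothesis char0 : forall n, n.+1%:R != 0 :> K.
Local Notation M := {malg K[seq V]}.
Implicit Types (u v w : seq V) (p : V * seq V).

Variable b : V -> V -> V.
Hypothesis b_linl : forall y, linear (b^~ y).
Hypothesis b_linr : forall x, linear (b x).

(** Moving the letter in position [j] of [w] to the front, past each earlier
    letter [x], creates words in which [x] is replaced by its bracket with that
    letter; [brackets w] collects these words for all positions [j]. *)
Fixpoint brackets w : M :=
  if w is x :: w' then
    lcons x (brackets w') + \sum_(p <- picks w') << b x p.1 :: p.2 >>
  else 0.

Fixpoint defect_rec n w : M :=
  if n is m.+1 then
    n%:R^-1 *: (brackets w + \sum_(p <- picks w) lcons p.1 (defect_rec m p.2))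
  else 0.

(** The word [w] is congruent to [sym w + defect w] in the enveloping algebra, and
    [defect w] is one letter shorter: [n] times [w] is the sum, over its [n]
    letters, of [w] with this letter moved to the front and of the corresponding
    brackets, and the rest of each word is treated recursively. *)
Definition defect w : M := defect_rec (size w) w.

Lemma defect_picks w :
  (size w)%:R *: defect w = brackets w + \sum_(p <- picks w) lcons p.1 (defect p.2).
Proof.
case: w => [|x w]; first by rewrite scale0r big_nil /= addr0.
rewrite /defect [size _]/= /defect_rec -/defect_rec scalerA mulfV // scale1r.
by congr (_ + _); apply: eq_big_seq => p /size_picks[<-].
Qed.

Lemma brackets_multilinear : multilinear (fun w => tens (brackets w)).
Proof.
move=> u v c x y; elim: u => [|z u IHu] /=; rewrite !tensD !tens_sum.
  rewrite scalerDr addrACA tens_lcons_linear; congr (_ + _).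
  rewrite scaler_sumr -big_split /=; apply: eq_bigr => p _.
  by rewrite b_linl (tens_multilinear [::]).
rewrite !scalerDr addrACA; congr (_ + _).
  rewrite -tensZ -tensD -linearP; apply: tens_lcons.
  by rewrite tensD tensZ; exact: IHu.
pose F w := if w is s :: w' then tens << b z s :: w' >> else 0.
have Fm : multilinear F.
  apply: multilinear_cons => [w d s t|s u' v'] /=.
    by rewrite b_linr (tens_multilinear [::]).
  exact: (tens_multilinear (b z s :: u')).
exact: (multilinear_picks Fm).
Qed.

Lemma defect_rec_multilinear n : multilinear (fun w => tens (defect_rec n w)).
Proof.
elim: n => [|n IHn] /=.
  by move=> u v c x y; rewrite linear0 scaler0 addr0.
pose F w := if w is x :: w' then tens (lcons x (defect_rec n w')) else 0.
have Fm : multilinear F.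
  apply: multilinear_cons => [w|x] /=; first exact: tens_lcons_linear.
  exact: multilinear_lcons.
apply: eq_multilinear (multilinear_scale _
  (multilinear_lin brackets_multilinear (multilinear_picks Fm))) => w /=.
by rewrite tensZ tensD tens_sum.
Qed.

Fixpoint pbw_rec n w : M :=
  if n is m.+1 then sym_rec n w + linext (pbw_rec m) (defect_rec n w)
  else << w >>.

(** Iterating [w = sym w + defect w] expresses [w] through symmetrized words; the
    result will be the unique combination of symmetric tensors congruent to [w],
    as in the Poincare-Birkhoff-Witt theorem. *)
Definition pbw : M -> M := linext (fun w => pbw_rec (size w) w).
HB.instance Definition _ := GRing.Linear.on pbw.

Lemma pbw_rec_multilinear n : multilinear (fun w => tens (pbw_rec n w)).
Proof.
elim: n => [|n IHn] /=; first exact: tens_multilinear.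
apply: eq_multilinear (multilinear_lin (@sym_rec_multilinear K V n.+1)
  (multilinear_comp IHn (defect_rec_multilinear n.+1))) => w /=.
by rewrite tensD (linear_linext (@tens K V)).
Qed.

Lemma tens_pbw f f' : tens f = tens f' -> tens (pbw f) = tens (pbw f').
Proof.
rewrite /pbw !(linear_linext (@tens K V)); apply: linext_tens => u v c x y.
by rewrite !size_cat /=; exact: pbw_rec_multilinear.
Qed.

End Straightening.

(** * Independent words *)

Section IndependentWords.
Variables (K : fieldType) (V : lmodType K) (top : rel V).
Hypothesis topC : symmetric top.
Local Notation M := {malg K[seq V]}.
Local Notation F := (Floc top).

Lemma indepE w : indep top w = pairwise top w.
Proof.
apply/asboolP/(pairwiseP 0) => [ind i j iw jw ij|pw i j iw jw].
  by apply: ind => //; rewrite ltn_eqF.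
rewrite neq_ltn => /orP[ij|ji]; first exact: pw.
by rewrite topC; exact: pw.
Qed.

Lemma FinclE (f : F) : Fincl f = linext (fun w : iword top => << sval w >>) f.
Proof. by rewrite unlock. Qed.

Lemma Fincl_word w : pairwise top w -> Fincl (word top w) = << w >> :> M.
Proof.
rewrite -indepE /word FinclE => iw; case: insubP => [u _ uw|]; last by rewrite iw.
by rewrite linextU -uw.
Qed.

Lemma Fincl_inj : injective (@Fincl K V top).
Proof.
move=> f h /malgP fh; apply/malgP => u; have := fh (sval u).
by rewrite !Fincl_coef valK.
Qed.

Lemma Fincl_supported (f : F) : Fincl f \in supported (pairwise top).
Proof.
rewrite FinclE unlock; apply: supported_sum => u _; apply: supportedZ.
by apply: supportedU; rewrite -indepE; exact: (valP u).
Qed.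

(** A left inverse of [Fincl], which allows computing in the space of all words. *)
Definition Floc_of : M -> F := linext (word top).
HB.instance Definition _ := GRing.Linear.on Floc_of.

Lemma Floc_ofU w : Floc_of << w >> = word top w.
Proof. exact: linextU. Qed.

Lemma Floc_ofK h : h \in supported (pairwise top) -> Fincl (Floc_of h) = h.
Proof.
pose L : {linear M -> M} := @Fincl K V top \o Floc_of.
apply: (@eq_on_supported _ _ _ _ L idfun) => w gw.
by rewrite /L /= Floc_ofU Fincl_word.
Qed.

Lemma FinclK : cancel (@Fincl K V top) Floc_of.
Proof. by move=> f; apply: Fincl_inj; rewrite Floc_ofK // Fincl_supported. Qed.

Lemma FdegP (N : pred nat) (f : F) :
  f \in Fdeg N <-> Fincl f \in supported (fun w => N (size w)).
Proof.
split=> [/allP fN|fN].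
  rewrite FinclE unlock big_seq -big_seq; apply: supported_sum => u uf.
  by apply: supportedZ; apply: supportedU; exact: fN.
apply/allP => u; rewrite -mcoeff_neq0 => fu.
apply: (msupp_supported fN); rewrite -mcoeff_neq0 Fincl_coef valK; exact: fu.
Qed.

Lemma Ffilt_exists (f : F) : exists n, f \in Ffilt top n.
Proof.
exists (\max_(u <- msupp f) size (sval u)); apply/allP => u uf.
exact: (@leq_bigmax_seq _ _ predT (fun u : iword top => size (sval u)) _ uf).
Qed.

Lemma Ffilt_mono n m (f : F) : (n <= m)%N -> f \in Ffilt top n -> f \in Ffilt top m.
Proof. by move=> nm /allP fn; apply/allP => u /fn un; exact: leq_trans nm. Qed.

Lemma toptimesP (f h : F) : reflect
  (forall u v, u \in msupp f -> v \in msupp h -> allrel top (sval u) (sval v))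
  (toptimes top f h).
Proof.
apply: (iffP (asboolP _)) => fh u v uf vh.
  by apply/allrelP => x y; exact: fh.
by move=> x y; apply/allrelP; exact: fh.
Qed.

Lemma toptimesC (f h : F) : toptimes top f h -> toptimes top h f.
Proof.
move=> /toptimesP fh; apply/toptimesP => u v uf vh.
by rewrite allrelC (eq_allrel (r' := top)) ?fh // => x y; rewrite topC.
Qed.

Lemma toptimes_word u v : allrel top u v -> toptimes top (word top u) (word top v).
Proof.
move=> uv; apply/toptimesP => u' v'; rewrite /word.
case: insubP => [u1 _ eu|_] /=; last by rewrite msupp0 inE.
case: insubP => [v1 _ ev|_] /=; last by rewrite msupp0 inE.
by move=> /mem_msuppU-> /mem_msuppU->; rewrite eu ev.
Qed.

Lemma toptimes_supported (P Q : seq V -> Prop) (f h : F) :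
  Fincl f \in supported P -> Fincl h \in supported Q ->
  (forall u v, P u -> Q v -> allrel top u v) -> toptimes top f h.
Proof.
have supp (R : seq V -> Prop) (e : F) : Fincl e \in supported R ->
    forall u, u \in msupp e -> R (sval u).
  move=> eR u ue; apply: (msupp_supported eR).
  by rewrite -mcoeff_neq0 Fincl_coef valK mcoeff_neq0.
move=> fP hQ PQ; apply/toptimesP => u v uf vh.
by apply: PQ; [exact: (supp _ _ fP) | exact: (supp _ _ hQ)].
Qed.

Lemma toptimes0 (h : F) : toptimes top 0 h.
Proof. by apply/toptimesP => u v; rewrite msupp0 inE. Qed.

Lemma FmulE (f h : F) : Fmul f h =
  bilext (fun u v : iword top => word top (sval u ++ sval v)) f h.
Proof. by rewrite bilextE. Qed.

(** All concatenations that occur are independent, so none of them is lost by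
    [word]. *)
Lemma FincLmul (f h : F) : toptimes top f h ->
  Fincl (Fmul f h) = cat_malg (Fincl f) (Fincl h).
Proof.
move=> /toptimesP fh; rewrite /cat_malg {2 3}/Fincl.
rewrite bilext_suml /Fmul linear_sum big_seq [RHS]big_seq.
apply: eq_bigr => u uf; rewrite bilext_sumr linear_sum big_seq [RHS]big_seq.
apply: eq_bigr => v vh; rewrite bilextZl bilextZr bilextUU linearZ scalerA.
congr (_ *: _); apply: Fincl_word; rewrite pairwise_cat fh //= -!indepE.
by rewrite (valP u) (valP v).
Qed.

Lemma Tproj_eq (f h : F) : Tproj f = Tproj h <-> tens (Fincl f) = tens (Fincl h).
Proof.
by split=> [/eq_qproj|] => fh; [apply/tens_eq; rewrite -linearB | apply/eq_qproj;
  rewrite /multT unfold_in linearB; apply/tens_eq].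
Qed.

Lemma Tproj_exists (t : Tloc top) : exists f : F, t = Tproj f.
Proof. exact: qprojP. Qed.

Lemma TprojP (c : K) (f h : F) : Tproj (c *: f + h) = c *: Tproj f + Tproj h.
Proof. exact: linearP. Qed.

Lemma Tprod_cat (f h : F) : toptimes top f h ->
  Tprod (Tproj f) (Tproj h) (Tproj (Fmul f h)).
Proof.
move=> fh; have [n fn] := Ffilt_exists f; have [m hm] := Ffilt_exists h.
exists (maxn n m), f, h; split=> //.
  by apply: Ffilt_mono fn; exact: leq_maxl.
by apply: Ffilt_mono hm; exact: leq_maxr.
Qed.

Lemma topotimes_Tproj (f h : F) : toptimes top f h ->
  topotimes top (Tproj f) (Tproj h).
Proof.
move=> fh; have [n fn] := Ffilt_exists f; have [m hm] := Ffilt_exists h.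
apply/asboolP; exists (maxn n m), f, h; split=> //.
  by apply: Ffilt_mono fn; exact: leq_maxl.
by apply: Ffilt_mono hm; exact: leq_maxr.
Qed.

End IndependentWords.

(** * A globally defined bilinear bracket *)

Section BracketExtension.
Variables (K : fieldType) (V : lmodType K) (top : rel V) (br : V -> V -> V).
Hypothesis topC : symmetric top.
Hypothesis br_bilinear : toptimes_bilinear top br.

Lemma Imult_supported (N : pred nat) f :
  f \in @Imult K V N -> f \in supported (fun w => N (size w)).
Proof.
move: f; apply: lspan_ind => [|c f h|f [k Nk]]; first exact: supported0.
  exact: supported_lin.
have sU w : size w = k -> << w >> \in supported (K := K) (fun w : seq V => N (size w)).
  by move=> wk; apply: supportedU; rewrite wk.
by case=> [u v x y|u v c x] uvk; rewrite ?supportedB ?supportedZ ?sU // size_cat.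
Qed.

(** Bilinearity of the partial bracket says that it factors through a subspace of
    the degree-two part of the tensor algebra; extending linearly from this
    subspace gives a bracket of arbitrary pairs. The extension need not be
    antisymmetric or satisfy the Jacobi identity, but multilinear operations
    built with it make sense on all words. *)
Lemma bracket_extension : exists b : V -> V -> V,
  [/\ forall y, linear (b^~ y), forall x, linear (b x)
    & forall x y, top x y -> b x y = br x y].
Proof.
pose q := qproj (@Imult_closed K V (pred1 2)).
pose i : {linear Floc top -> _} := q \o @Fincl K V top.
pose l := linext (fun w : iword top => br (sval w)`_0 (sval w)`_1).
have [|L Li] := @linear_extension K (Floc top) _ V i l.
  move=> f /qproj_eq0 f0; rewrite /l /= unlock; apply: br_bilinear.
  by apply/andP; split=> //; apply/FdegP/Imult_supported.
pose b x y := L (q << [:: x; y] >>).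
have qm := @qproj_multilinear K V (pred1 2).
exists b; split=> [y c x x'|x c y y'|x y xy].
- by rewrite /b /q (qm [::] [:: y]) // linearP.
- by rewrite /b /q (qm [:: x] [::]) // linearP.
have gxy : pairwise top [:: x; y] by rewrite /= xy.
have := Li (word top [:: x; y]); rewrite /i /= Fincl_word // /b /q => ->.
rewrite /l /word; case: insubP => [u _ uxy|] /=; first by rewrite linextU uxy.
by rewrite indepE // gxy.
Qed.

End BracketExtension.

(** * Relations of the enveloping algebra *)

Lemma perm_pairwise (T : eqType) (r : rel T) : symmetric r ->
  forall s t, perm_eq s t -> pairwise r s = pairwise r t.
Proof.
move=> rC; elim=> [|x s IHs] t; first by rewrite perm_sym => /perm_nilP->.
move=> st; have xt : x \in t by rewrite -(perm_mem st) mem_head.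
case/splitPr: xt st => t1 t2 st.
have {}st : perm_eq s (t1 ++ t2).
  by rewrite -(perm_cons x) (perm_trans st) // perm_sym -cat1s perm_catCA.
rewrite /= (IHs _ st) (perm_all _ st) !pairwise_cat /= allrel_consr all_cat.
have -> : all (r^~ x) t1 = all (r x) t1 by apply: eq_all => y; rewrite rC.
by do !case: (all _ _) => //=; rewrite ?andbF.
Qed.

Section Relations.
Variables (K : fieldType) (V : lmodType K) (top : rel V) (b : V -> V -> V).
Local Notation M := {malg K[seq V]}.

(** The relations of the enveloping algebra. The context [C] keeps track of the
    letters by which the words may still be multiplied, and the bound [n] on
    lengths makes induction on the degree possible. *)
Variant env_gen (C : seq V) (n : nat) : M -> Prop :=
| EnvSwap u x y v of pairwise top (C ++ u ++ x :: y :: v)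
    & ((size u + size v).+2 <= n)%N :
    env_gen C n (<< u ++ x :: y :: v >> - << u ++ y :: x :: v >>
                 - << u ++ b x y :: v >>)
| EnvMult f of f \in Imult predT : env_gen C n f.

Definition env_rel C n : {pred M} := lspan (env_gen C n).

Lemma env_rel_closed C n : submod_closed (env_rel C n).
Proof. exact: lspan_closed. Qed.

End Relations.

HB.lock Definition env (K : fieldType) (V : lmodType K) (top : rel V)
  (b : V -> V -> V) (C : seq V) (n : nat) (f : {malg K[seq V]}) :
  lquot (env_rel_closed top b C n) := qproj (env_rel_closed top b C n) f.

Section Enveloping.
Variables (K : fieldType) (V : lmodType K).
Hypothesis char0 : forall n, n.+1%:R != 0 :> K.
Local Notation M := {malg K[seq V]}.
Implicit Types (u v w C : seq V) (p : V * seq V).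

Variables (top : rel V) (br b : V -> V -> V).
Hypothesis topC : symmetric top.
Hypothesis b_linl : forall y, linear (b^~ y).
Hypothesis b_linr : forall x, linear (b x).
Hypothesis b_anti : forall x y, top x y -> b x y = - b y x.
Hypothesis b_top : forall x y z, top x y -> top x z -> top y z -> top (b x y) z.
Hypothesis b_jacobi : forall x y z, top x y -> top y z -> top x z ->
  b x (b y z) + b y (b z x) + b z (b x y) = 0.

Local Notation env C n := (@env K V top b C n).
Local Notation brackets := (brackets b).
Local Notation defect := (defect b).
Local Notation pbw := (pbw b).

Fact env_is_linear C n : linear (env C n).
Proof. by move=> c x y; rewrite env.unlock linearP. Qed.
HB.instance Definition _ C n :=
  GRing.isLinear.Build K M _ _ (env C n) (env_is_linear C n).

Lemma envD C n f f' : env C n (f + f') = env C n f + env C n f'.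
Proof. exact: linearD. Qed.

Lemma env0 C n : env C n 0 = 0.
Proof. exact: linear0. Qed.

Lemma envZ C n c f : env C n (c *: f) = c *: env C n f.
Proof. exact: linearZ. Qed.

Lemma env_sum C n (I : Type) (r : seq I) (F : I -> M) :
  env C n (\sum_(i <- r) F i) = \sum_(i <- r) env C n (F i).
Proof. exact: linear_sum. Qed.

Lemma env_eq C n f f' :
  env C n f = env C n f' <-> f - f' \in env_rel top b C n.
Proof. by rewrite env.unlock; exact: eq_qproj. Qed.

Lemma env_eq0 C n f : env C n f = 0 <-> f \in env_rel top b C n.
Proof. by rewrite env.unlock; exact: qproj_eq0. Qed.

Lemma env_map (W : lmodType K) (L : {linear M -> W}) C n f f' :
  (forall u x y v, pairwise top (C ++ u ++ x :: y :: v) ->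
    ((size u + size v).+2 <= n)%N ->
    L << u ++ x :: y :: v >> =
      L << u ++ y :: x :: v >> + L << u ++ b x y :: v >>) ->
  (forall h, tens h = 0 -> L h = 0) ->
  env C n f = env C n f' -> L f = L f'.
Proof.
move=> Lswap Lmul /env_eq ff'; apply/eqP; rewrite -subr_eq0 -linearB; apply/eqP.
move: {f f'}(f - f') ff'; apply: lspan_ind => [|c h h' eh eh'|h].
- exact: linear0.
- by rewrite linearP /= eh eh' scaler0 addr0.
- case=> [u x y v good sz|{}h /tens_eq0/Lmul//].
  by rewrite !linearB /= (Lswap u x y v) // addrAC addrK subrr.
Qed.

Lemma env_tens C n f f' : tens f = tens f' -> env C n f = env C n f'.
Proof.
by move/tens_eq => ff'; apply/env_eq/mem_lspan; apply: EnvMult.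
Qed.

Lemma env_tens0 C n f : tens f = 0 -> env C n f = 0.
Proof. by move/tens_eq0 => f0; apply/env_eq0/mem_lspan; apply: EnvMult. Qed.

Lemma env_swap C n u x y v :
  pairwise top (C ++ u ++ x :: y :: v) -> ((size u + size v).+2 <= n)%N ->
  env C n << u ++ x :: y :: v >> =
  env C n << u ++ y :: x :: v >> + env C n << u ++ b x y :: v >>.
Proof.
move=> good sz; rewrite -envD; apply/env_eq; rewrite opprD addrA.
by apply: mem_lspan; apply: EnvSwap.
Qed.

(** Multiplying by a letter moves it from the context to the words. *)
Lemma env_lcons C n x f f' : env (rcons C x) n f = env (rcons C x) n f' ->
  env C n.+1 (lcons x f) = env C n.+1 (lcons x f').
Proof.
pose L f := env C n.+1 (lcons x f).
have Ll : linear L by move=> c h h'; rewrite /L !linearP.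
pose LL : {linear M -> _} := HB.pack L (GRing.isLinear.Build K M _ _ L Ll).
apply: (env_map (L := LL)) => [u y z v|h h0] /=; rewrite /L.
  rewrite cat_rcons !lconsU => good sz.
  by rewrite -!cat_cons env_swap.
exact/env_tens0/tens_lcons0.
Qed.

Lemma good_perm C w w' :
  perm_eq w w' -> pairwise top (C ++ w) -> pairwise top (C ++ w').
Proof. by move=> ww'; rewrite (perm_pairwise topC (t := C ++ w')) // perm_cat2l. Qed.

(** A letter independent of both [x] and [y] is independent of their bracket, so
    the relations never leave the independent words. *)
Lemma good_bracket C u x y v : pairwise top (C ++ u ++ x :: y :: v) ->
  pairwise top (C ++ u ++ b x y :: v).
Proof.
have front z s : perm_eq (C ++ u ++ z :: s) (z :: C ++ u ++ s).
  by rewrite !catA -(cat1s z s) perm_catCA.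
rewrite !(perm_pairwise topC (front _ _)) /= (perm_pairwise topC (front _ _)).
rewrite (perm_all _ (front _ _)) /= -!andbA.
case/and4P=> xy xs ys ->; rewrite andbT; apply/allP => z zs.
by apply: b_top => //; [exact: (allP xs) | exact: (allP ys)].
Qed.

Lemma lcons_supported (P P' : seq V -> Prop) x (f : M) :
  (forall w, P w -> P' (x :: w)) -> f \in supported P ->
  lcons x f \in supported P'.
Proof.
move=> PP'; move: f; apply: supported_ind => [|c f h fP hP|w /PP' P'w].
- by rewrite linear0 supported0.
- by rewrite linearP; exact: supported_lin.
- by rewrite lconsU; exact: supportedU.
Qed.

Lemma good_pick C w p : p \in picks w ->
  pairwise top (C ++ w) -> pairwise top (rcons C p.1 ++ p.2).
Proof.
by move=> /picks_perm; rewrite cat_rcons perm_sym; exact: good_perm.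
Qed.

Definition good_size C n : seq V -> Prop := fun s => pairwise top (C ++ s) /\ size s = n.

Lemma lcons_good C n x f : f \in supported (good_size (rcons C x) n) ->
  lcons x f \in supported (good_size C n.+1).
Proof.
by apply: lcons_supported => s []; rewrite cat_rcons => ? <-.
Qed.

Lemma brackets_good C w : pairwise top (C ++ w) ->
  brackets w \in supported (good_size C (size w).-1).
Proof.
elim: w C => [|x w IHw] C gw; first exact: supported0.
apply: supportedD.
  case: w => [|y w] in IHw gw *; first by rewrite linear0 supported0.
  by apply: lcons_good; apply: IHw; rewrite cat_rcons.
apply: supported_sum => p pw; apply: supportedU; split; last first.
  by rewrite /= (size_picks pw).
apply: (good_bracket (u := [::])).
by apply: good_perm gw; rewrite perm_cons perm_sym; exact: picks_perm.
Qed.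

Lemma scaled_supported (P : seq V -> Prop) n (f : M) :
  n.+1%:R *: f \in supported P -> f \in supported P.
Proof.
move=> nf; rewrite -[f]scale1r -(mulVf (char0 n)) -scalerA.
exact: supportedZ.
Qed.

Lemma sym_good C w : pairwise top (C ++ w) -> sym w \in supported (good_size C (size w)).
Proof.
have [n] := ubnP (size w); elim: n w C => // n IHn [|x w] C; rewrite ltnS => szw gw.
  by apply: supportedU; split.
apply: (@scaled_supported _ (size w)); rewrite -[(size w).+1]/(size (x :: w)).
rewrite sym_picks //; apply: supported_sum => p pw; have szp := size_picks pw.
rewrite szp; apply/lcons_good/IHn; last exact: good_pick gw.
by rewrite -szp.
Qed.

Lemma defect_good C w : pairwise top (C ++ w) ->
  defect w \in supported (good_size C (size w).-1).
Proof.
have [n] := ubnP (size w); elim: n w C => // n IHn [|x w] C; rewrite ltnS => szw gw.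
  exact: supported0.
apply: (@scaled_supported _ (size w)); rewrite -[(size w).+1]/(size (x :: w)).
rewrite defect_picks //; apply: supportedD; first exact: brackets_good.
apply: supported_sum => p pw; have szp := size_picks pw; rewrite szp /=.
have := good_pick pw gw; case: p {pw} szp => y [|z s] /= szp gp.
  by rewrite linear0 supported0.
apply/lcons_good; rewrite -[size s]/(size (z :: s)).-1; apply: IHn.
  by rewrite -szp.
exact: gp.
Qed.

Lemma pbw_word C w : pairwise top (C ++ w) -> pbw << w >> = sym w + pbw (defect w).
Proof.
case: w => [|x w] gw; first by rewrite /pbw linextU /= /defect /= linear0 addr0.
rewrite {1}/pbw linextU; congr (_ + _).
apply: (eq_on_supported _ (defect_good gw)) => s [_ /= szs].
by rewrite /pbw !linextU szs.
Qed.

(** ** Straightening modulo the relations *)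

(** Each letter in turn is moved to the front by exchanges of neighbours; summing
    over the letters gives [size w] copies of [w]. *)
Lemma env_front C n w : pairwise top (C ++ w) -> (size w <= n)%N ->
  (size w)%:R *: env C n << w >> =
  env C n (brackets w) + \sum_(p <- picks w) env C n << p.1 :: p.2 >>.
Proof.
elim: w C n => [|x w IHw] C n gw; first by rewrite scale0r big_nil linear0 addr0.
case: n => // n; rewrite ltnS => szw.
rewrite /= -natr1 scalerDl scale1r sum_picks_cons /= envD env_sum.
have -> : (size w)%:R *: env C n.+1 << x :: w >> =
    env C n.+1 (lcons x (brackets w + \sum_(p <- picks w) << p.1 :: p.2 >>)).
  rewrite -envZ -lconsU -lconsZ; apply: env_lcons.
  by rewrite envZ IHw ?cat_rcons // envD env_sum.
rewrite lconsD lcons_sum envD env_sum -!addrA; congr (_ + _).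
rewrite [RHS]addrCA [in RHS]addrC -big_split /=; congr (_ + _).
rewrite big_seq [RHS]big_seq; apply: eq_bigr => p pw; rewrite lconsU.
rewrite (env_swap (u := [::])) 1?addrC //; last by rewrite /= -(size_picks pw).
apply: good_perm gw; rewrite perm_cons perm_sym; exact: picks_perm.
Qed.

Lemma env_head_lin C n w c x y :
  env C n << (c *: x + y) :: w >> = c *: env C n << x :: w >> + env C n << y :: w >>.
Proof.
rewrite -envZ -envD; apply: env_tens.
by rewrite tensD tensZ; exact: (tens_multilinear [::]).
Qed.

Lemma env_headD C n w x y :
  env C n << (x + y) :: w >> = env C n << x :: w >> + env C n << y :: w >>.
Proof. by have := env_head_lin C n w 1 x y; rewrite !scale1r. Qed.

Lemma env_swap_head C n x y f :
  f \in supported (fun s => pairwise top (C ++ x :: y :: s) /\ ((size s).+2 <= n)%N) ->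
  env C n (lcons x (lcons y f)) =
  env C n (lcons y (lcons x f)) + env C n (lcons (b x y) f).
Proof.
move: f; apply: supported_ind => [|c f h ef eh|s [gs szs]].
- by rewrite !lcons0 !env0 addr0.
- by rewrite !lconsP !envD !envZ ef eh scalerDr addrACA.
- by rewrite !lconsU; exact: (env_swap (u := [::])).
Qed.

(** The Jacobi identity in the form of a derivation, which is how it occurs when
    a third letter is moved past [x] and [y]. *)
Lemma jacobi x y z : top x y -> top x z -> top y z ->
  b x (b y z) + b (b x z) y = b (b x y) z.
Proof.
move=> xy xz yz.
have bN s t : b s (- t) = - b s t.
  pose L : {linear V -> V} :=
    HB.pack (b s) (GRing.isLinear.Build K V V _ (b s) (b_linr s)).
  exact: (raddfN L).
have := b_jacobi xy yz xz; rewrite (b_anti (x := z) (y := x)) 1?topC // bN.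
rewrite [b y (b x z)]b_anti; last by rewrite topC; apply: b_top => //; rewrite topC.
rewrite [b z _]b_anti; last by rewrite topC; apply: b_top => //; rewrite topC.
by move/eqP; rewrite opprK subr_eq0 => /eqP.
Qed.

Lemma good_head C z y w w' : perm_eq w (y :: w') ->
  pairwise top (C ++ z :: w) -> pairwise top (C ++ b z y :: w').
Proof.
move=> ww' gw; apply: (good_bracket (u := [::])).
by apply: good_perm gw; rewrite perm_cons.
Qed.

Lemma env_headN C n x w : env C n << - x :: w >> = - env C n << x :: w >>.
Proof.
have e0 := env_head_lin C n w 0 x x; rewrite !scale0r !add0r in e0.
apply/eqP; rewrite -addr_eq0 -env_headD addNr.
have := env_headD C n w 0 0; rewrite addr0 => /eqP.
by rewrite -subr_eq0 opprD addrA subrr add0r oppr_eq0.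
Qed.

(** The effect on [brackets] of exchanging two neighbours [x] and [y]. A third
    letter moved past both contributes a bracket with [b x y], by the Jacobi
    identity; the pair itself contributes [u ++ b x y :: v] twice, because [b y x]
    is the opposite of [b x y]. One of the two copies absorbs the brackets of the
    letters of [u] with [b x y], which occur only in the second term on the right;
    this moves [b x y] to the front. *)
Lemma brackets_swap C n u x y v :
  pairwise top (C ++ u ++ x :: y :: v) -> (size u + size v < n)%N ->
  env C n (brackets (u ++ x :: y :: v)) =
  env C n (brackets (u ++ y :: x :: v)) + (env C n (brackets (u ++ b x y :: v)) +
    (env C n << b x y :: u ++ v >> + env C n << u ++ b x y :: v >>)).
Proof.
elim: u C n => [|z u IHu] C n gw szw.
  move: gw szw; rewrite /= add0n => gw szw.
  have [xy [xs ys]] : top x y /\ all (top x) v /\ all (top y) v.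
    by move: gw; rewrite pairwise_cat /= -!andbA => /and5P[_ _ -> ->] /andP[->].
  rewrite !sum_picks_cons /= !lconsD !lcons_sum !envD !env_sum.
  have -> : env C n (lcons x (lcons y (brackets v))) =
      env C n (lcons y (lcons x (brackets v))) + env C n (lcons (b x y) (brackets v)).
    apply: env_swap_head; have : pairwise top (rcons (rcons C x) y ++ v).
      by rewrite !cat_rcons.
    move=> /brackets_good; case: v szw {gw xs ys} => [|t v] szw.
      by move=> _; apply: supported0.
    apply: sub_supported => s [gs szs]; rewrite -!cat_rcons; split=> //.
    by rewrite szs /=.
  have e1 : \sum_(p <- picks v) env C n (lcons x << b y p.1 :: p.2 >>) =
     \sum_(p <- picks v) env C n << b y p.1 :: x :: p.2 >> +
     \sum_(p <- picks v) env C n << b x (b y p.1) :: p.2 >>.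
    rewrite -big_split big_seq [RHS]big_seq /=; apply: eq_bigr => p pv.
    rewrite lconsU; apply: (env_swap (u := [::])); last by rewrite /= -(size_picks pv).
    rewrite /= -cat_rcons; apply: good_head; last by rewrite cat_rcons; exact: gw.
    by rewrite perm_sym; exact: picks_perm.
  have e2 : \sum_(p <- picks v) env C n << b x p.1 :: y :: p.2 >> =
     \sum_(p <- picks v) env C n (lcons y << b x p.1 :: p.2 >>) +
     \sum_(p <- picks v) env C n << b (b x p.1) y :: p.2 >>.
    rewrite -big_split big_seq [RHS]big_seq /=; apply: eq_bigr => p pv.
    rewrite lconsU; apply: (env_swap (u := [::])); last by rewrite /= -(size_picks pv).
    apply: good_head; last exact: gw.
    by apply: (picks_perm_catl [:: y]).
  have e3 : \sum_(p <- picks v) env C n << b (b x y) p.1 :: p.2 >> =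
     \sum_(p <- picks v) env C n << b x (b y p.1) :: p.2 >> +
     \sum_(p <- picks v) env C n << b (b x p.1) y :: p.2 >>.
    rewrite -big_split big_seq [RHS]big_seq /=; apply: eq_bigr => p /picks_perm pv.
    have vp : p.1 \in v by rewrite -(perm_mem pv) mem_head.
    by rewrite -env_headD jacobi //; [exact: (allP xs) | exact: (allP ys)].
  rewrite e1 e2 e3 (b_anti (x := y) (y := x)) 1?topC // env_headN.
  (* The bracket of [x] and [y] occurs once on the left; on the right it occurs
     twice, and once with the opposite sign through [b y x]. *)
  set Z := env C n << b x y :: v >>.
  rewrite -[in LHS](addKr Z Z) !addrA.
  by rewrite [LHS](ACl (1*8*5*3*2*4*9*6*7)).
case: n => // n in szw *; rewrite /= !envD !env_sum.
have -> : env C n.+1 (lcons z (brackets (u ++ x :: y :: v))) =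
    env C n.+1 (lcons z (brackets (u ++ y :: x :: v) + (brackets (u ++ b x y :: v) +
      (<< b x y :: u ++ v >> + << u ++ b x y :: v >>)))).
  by apply: env_lcons; rewrite !envD IHu // cat_rcons.
rewrite !sum_picks_cat !sum_picks_cons /= !lconsD !envD !lconsU.
have -> : env C n.+1 << z :: b x y :: u ++ v >> =
    env C n.+1 << b x y :: z :: u ++ v >> + env C n.+1 << b z (b x y) :: u ++ v >>.
  apply: (env_swap (u := [::])); last by rewrite /= size_cat.
  rewrite /=; have := good_bracket gw; apply: good_perm.
  by rewrite /= perm_cons -(cat1s _ v) perm_catCA.
have e1 : \sum_(p <- picks u) env C n.+1 << b z p.1 :: p.2 ++ x :: y :: v >> =
   \sum_(p <- picks u) env C n.+1 << b z p.1 :: p.2 ++ y :: x :: v >> +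
   \sum_(p <- picks u) env C n.+1 << b z p.1 :: p.2 ++ b x y :: v >>.
  rewrite -big_split big_seq [RHS]big_seq /=; apply: eq_bigr => p pu.
  apply: (env_swap (u := _ :: _)); last first.
    by rewrite /= -(size_picks pu).
  by apply: good_head; last exact: gw; exact: picks_perm_catr.
have e2 : \sum_(p <- picks v) env C n.+1 << b z p.1 :: u ++ x :: y :: p.2 >> =
   \sum_(p <- picks v) env C n.+1 << b z p.1 :: u ++ y :: x :: p.2 >> +
   \sum_(p <- picks v) env C n.+1 << b z p.1 :: u ++ b x y :: p.2 >>.
  rewrite -big_split big_seq [RHS]big_seq /=; apply: eq_bigr => p pv.
  apply: (env_swap (u := _ :: _)); last first.
    by rewrite /= addSn -addnS -(size_picks pv).
  apply: good_head; last exact: gw.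
  have := picks_perm_catl (u ++ [:: x; y]) pv; rewrite -!catA; exact.
rewrite e1 e2 !addrA.
by rewrite [LHS](ACl (1*6*9*8*10*2*7*4*11*3*5)).
Qed.

(** This is the confluence that makes straightening well defined: [defect] is
    compatible with the relation that exchanges [x] and [y], up to relations
    between shorter words. The letters other than [x] and [y] are treated by
    induction; together with [brackets_swap] they produce all but one of the
    terms that [env_front] gives for [u ++ b x y :: v]. *)
Lemma defect_swap C n u x y v :
  pairwise top (C ++ u ++ x :: y :: v) -> (size u + size v < n)%N ->
  env C n (defect (u ++ x :: y :: v)) =
  env C n (defect (u ++ y :: x :: v)) + env C n << u ++ b x y :: v >>.
Proof.
have [m] := ubnP (size u + size v).
elim: m C n u v => // m IHm C n u v; rewrite ltnS => szm gw szn.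
set N := (size u + size v).+1.
apply: (scalerI (char0 N)).
have dE w : size w = N.+1 -> N.+1%:R *: env C n (defect w) =
    env C n (brackets w) + \sum_(p <- picks w) env C n (lcons p.1 (defect p.2)).
  by move=> <-; rewrite -envZ defect_picks // envD env_sum.
have fE : N.+1%:R *: env C n << u ++ b x y :: v >> =
    env C n << u ++ b x y :: v >> + (env C n (brackets (u ++ b x y :: v)) +
    \sum_(p <- picks (u ++ b x y :: v)) env C n << p.1 :: p.2 >>).
  rewrite -[in LHS]natr1 scalerDl scale1r addrC; congr (_ + _).
  have szb : size (u ++ b x y :: v) = N by rewrite size_cat /= addnS.
  rewrite -szb env_front ?szb //.
  exact: good_bracket.
rewrite scalerDr !dE ?fE; [|by rewrite size_cat /= !addnS ..].
rewrite brackets_swap //.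
rewrite !sum_picks_cat !sum_picks_cons /=.
have e1 : \sum_(p <- picks u) env C n (lcons p.1 (defect (p.2 ++ x :: y :: v))) =
   \sum_(p <- picks u) env C n (lcons p.1 (defect (p.2 ++ y :: x :: v))) +
   \sum_(p <- picks u) env C n << p.1 :: p.2 ++ b x y :: v >>.
  rewrite -big_split big_seq [RHS]big_seq /=; apply: eq_bigr => p pu.
  have szp := size_picks pu; case: n szn {dE fE} => // n; rewrite ltnS => szn.
  rewrite -envD -lconsU -lconsD; apply: env_lcons; rewrite envD; apply: IHm.
  - by move: szm; rewrite szp.
  - rewrite cat_rcons; apply: good_perm gw.
    exact: (picks_perm_catr (x :: y :: v)).
  - by move: szn; rewrite szp.
have e2 : \sum_(p <- picks v) env C n (lcons p.1 (defect (u ++ x :: y :: p.2))) =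
   \sum_(p <- picks v) env C n (lcons p.1 (defect (u ++ y :: x :: p.2))) +
   \sum_(p <- picks v) env C n << p.1 :: u ++ b x y :: p.2 >>.
  rewrite -big_split big_seq [RHS]big_seq /=; apply: eq_bigr => p pv.
  have szp := size_picks pv; case: n szn {dE fE e1} => // n; rewrite ltnS => szn.
  rewrite -envD -lconsU -lconsD; apply: env_lcons; rewrite envD; apply: IHm.
  - by move: szm; rewrite szp addnS.
  - rewrite cat_rcons; apply: good_perm gw.
    have := picks_perm_catl (u ++ [:: x; y]) pv; rewrite -!catA; exact.
  - by move: szn; rewrite szp addnS.
rewrite e1 e2 !addrA.
by rewrite [LHS](ACl (1*5*8*7*9*4*2*6*3*10)).
Qed.

(** By [sym_swap] and [defect_swap], the images of the two sides of a relation of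
    length [n.+1] differ by the image of relations of length at most [n]. *)
Lemma env_pbw C n f f' : env C n f = env C n f' -> tens (pbw f) = tens (pbw f').
Proof.
pose L : {linear M -> tensor V} := @tens K V \o pbw.
elim: n f f' => [|n IHn] f f'.
  apply: (env_map (L := L)) => [u x y v _ //|h h0].
  by rewrite /= (tens_pbw b_linl b_linr (f' := 0)) ?linear0.
apply: (env_map (L := L)) => [u x y v gw sz|h h0]; last first.
  by rewrite /= (tens_pbw b_linl b_linr (f' := 0)) ?linear0.
have gw' : pairwise top (C ++ u ++ y :: x :: v).
  apply: good_perm gw; rewrite perm_cat2l.
  by rewrite (perm_catCA [:: x] [:: y] v).
rewrite /= (pbw_word gw) (pbw_word gw').
rewrite (sym_swap char0) !tensD -addrA; congr (_ + _).
rewrite -tensD -linearD; apply: IHn; rewrite envD; exact: defect_swap.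
Qed.

(** Both sides satisfy the recursion of [env_front]. *)
Lemma env_sym_defect C n w : pairwise top (C ++ w) -> (size w <= n)%N ->
  env C n << w >> = env C n (sym w) + env C n (defect w).
Proof.
elim: n w C => [|n IHn] [|x w] C // gw szw; first by rewrite env0 addr0.
  by rewrite env0 addr0.
apply: (scalerI (char0 (size w))); rewrite -[(size w).+1]/(size (x :: w)).
rewrite env_front // scalerDr -!envZ.
rewrite sym_picks // defect_picks // envD addrCA; congr (_ + _).
rewrite !env_sum -big_split big_seq [RHS]big_seq; apply: eq_bigr => p pw /=.
rewrite -envD -lconsD -lconsU; apply: env_lcons; rewrite envD; apply: IHn.
  exact: (good_pick pw gw).
by move: szw; rewrite (size_picks pw).
Qed.

Lemma env_pbw_id C n f :
  f \in supported (fun w => pairwise top (C ++ w) /\ (size w <= n)%N) ->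
  env C n (pbw f) = env C n f.
Proof.
suff word w : pairwise top (C ++ w) -> (size w <= n)%N ->
    env C n (pbw << w >>) = env C n << w >>.
  move: f; apply: (@eq_on_supported _ _ _ _ (env C n \o pbw) (env C n)) => w [].
  exact: word.
have [m] := ubnP (size w); elim: m w => // m IHm w; rewrite ltnS => szm gw szn.
rewrite (pbw_word gw) envD env_sym_defect //; congr (_ + _).
case: w => [|x w] in szm gw szn *; first by rewrite !linear0.
have := defect_good gw.
apply: (@eq_on_supported _ _ _ _ (env C n \o pbw) (env C n)) => s [gs /= szs].
by apply: IHm => //; rewrite szs // ltnW.
Qed.

(** [w] and [pbw w] are congruent, and [pbw] takes equal values on congruent
    combinations. *)
Lemma pbw_idem f : f \in supported (pairwise top) -> tens (pbw (pbw f)) = tens (pbw f).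
Proof.
pose L : {linear M -> tensor V} := @tens K V \o pbw.
apply: (@eq_on_supported _ _ _ _ (L \o pbw) L) => w gw.
apply: (@env_pbw [::] (size w)); apply: env_pbw_id.
by apply: supportedU.
Qed.

(** Symmetrized words are in normal form. Compare [pbw (pbw w)] with [pbw w],
    where [pbw w] is the sum of [sym w] and of [pbw (defect w)]. *)
Lemma pbw_sym w : pairwise top w -> tens (pbw (sym w)) = tens (sym w).
Proof.
move=> gw; have := pbw_idem (@supportedU K _ (pairwise top) w gw).
rewrite (pbw_word (C := [::]) gw) linearD !tensD.
rewrite (@pbw_idem (defect w)); first by move/addIr.
apply: sub_supported (defect_good (C := [::]) gw) => s [] //.
Qed.

Lemma env_catr n v f f' : env v n f = env v n f' ->
  env [::] (n + size v) (cat_malg f << v >>) =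
  env [::] (n + size v) (cat_malg f' << v >>).
Proof.
have catE h : cat_malg h << v >> = linext (fun u => << u ++ v >>) h.
  by rewrite cat_malgC linextU.
pose L : {linear M -> _} := env [::] (n + size v) \o linext (fun u => << u ++ v >>).
rewrite !catE; apply: (env_map (L := L)) => [u x y w gw sz|h h0] /=; last first.
  apply: env_tens0; rewrite -catE -tens0 -(cat_malg0l << v >>).
  by apply: tens_cat => //; rewrite h0 tens0.
rewrite !linextU -!catA; apply: env_swap; last first.
  by rewrite size_cat addnA -[_.+2]/(2 + _)%N addnA leq_add2r.
have uvP : perm_eq ((u ++ x :: y :: w) ++ v) (v ++ u ++ x :: y :: w).
  by rewrite perm_catC.
by rewrite -(perm_pairwise topC uvP) -catA in gw.
Qed.

Lemma env_catl n v f f' : env v n f = env v n f' ->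
  env [::] (size v + n) (cat_malg << v >> f) =
  env [::] (size v + n) (cat_malg << v >> f').
Proof.
pose L : {linear M -> _} := env [::] (size v + n) \o cat_malg << v >>.
apply: (env_map (L := L)) => [u x y w gw sz|h h0] /=; last first.
  apply: env_tens0; rewrite -tens0 -(linear0 (cat_malg << v >>)).
  by apply: tens_cat => //; rewrite h0 tens0.
rewrite !cat_malgUU !catA; apply: env_swap; last first.
  by rewrite size_cat -addnA -2!addnS leq_add2l.
by rewrite -catA.
Qed.

(** If [f] straightens to zero and its words are independent of [v], then all
    relations used to straighten [f] have words independent of [v], hence may be
    multiplied by [v]. *)
Section Ideal.
Variables (n : nat) (v : seq V) (f : M).
Hypothesis fv : f \in supported (fun w => pairwise top (v ++ w) /\ (size w <= n)%N).
Hypothesis f0 : tens (pbw f) = 0.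

Let f_env : env v n f = env v n 0.
Proof.
rewrite -(env_pbw_id fv); apply: env_tens.
by rewrite f0 tens0.
Qed.

Lemma pbw_catr : tens (pbw (cat_malg f << v >>)) = 0.
Proof.
rewrite (env_pbw (env_catr f_env)).
by rewrite cat_malg0l linear0 tens0.
Qed.

Lemma pbw_catl : tens (pbw (cat_malg << v >> f)) = 0.
Proof.
rewrite (env_pbw (env_catl f_env)).
by rewrite !linear0.
Qed.

End Ideal.

Lemma pbw1 x : pbw << [:: x] >> = << [:: x] >>.
Proof.
rewrite (pbw_word (C := [::])) //.
have -> : defect [:: x] = 0.
  have := defect_picks char0 b [:: x]; rewrite scale1r big_seq1 /= big_nil => ->.
  by rewrite /defect /= !lcons0 !addr0.
by rewrite sym1 // linear0 addr0.
Qed.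

Lemma pbw_nil : pbw << [::] >> = << [::] >>.
Proof. by rewrite /pbw linextU. Qed.

Definition le1 (n : nat) : K := (n <= 1)%:R.

(** The convolution product of the part of degree at most one with the identity,
    for the unshuffling coproduct and the concatenation of symmetric
    representatives. *)
Definition conv_form u v : tensor V :=
  tens (cat_malg (deg_scale le1 (pbw << u >>)) (pbw << v >>)).

Lemma bilext_conv f h :
  bilext conv_form f h = tens (cat_malg (deg_scale le1 (pbw f)) (pbw h)).
Proof.
apply: (bilext_unique
  (B := fun f h => tens (cat_malg (deg_scale le1 (pbw f)) (pbw h)))) => // x c y z.
  by rewrite [pbw _]linearP [deg_scale _ _]linearP cat_malgPl tensD tensZ.
by rewrite [pbw (_ + _)]linearP [cat_malg _ _]linearP tensD tensZ.
Qed.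

Lemma deg_scale_sym d w : pairwise top w ->
  deg_scale d (sym w) = d (size w) *: sym w :> M.
Proof.
move=> gw; pose L : {linear M -> M} := *:%R (d (size w)).
apply: (eq_on_supported (L := deg_scale d) (L' := L) _ (@sym_good [::] w gw)).
by move=> s [_ szs]; rewrite /= deg_scaleU szs.
Qed.

(** Symmetrized words are an eigenspace of the convolution: the empty first part
    contributes [sym w], and the one-letter first parts recombine to
    [size w] copies of [sym w], by the recursion defining [sym]. *)
Lemma conv_sym w : pairwise top w ->
  unshuffle_pairing conv_form (sym w) = (size w).+1%:R *: tens (sym w).
Proof.
move=> gw; rewrite (unshuffle_pairing_sym char0).
pose F u v := tens (cat_malg (sym u) (sym v)) : tensor V.
transitivity (\sum_(p <- unshuffles w) (size p.1 <= 1)%:R *: F p.1 p.2).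
  rewrite big_seq [RHS]big_seq; apply: eq_bigr => p /unshuffles_perm pw.
  have : pairwise top (p.1 ++ p.2) by rewrite (perm_pairwise topC pw).
  rewrite pairwise_cat => /and3P[_ g1 g2].
  have pbwS u : pairwise top u -> tens (pbw (sym u)) = tens (sym u).
    exact: pbw_sym.
  rewrite bilext_conv /F -tensZ -[_%:R *: cat_malg _ _]addr0.
  rewrite -(cat_malg0l (sym p.2)) -cat_malgPl addr0 -[_%:R]/(le1 (size p.1)).
  rewrite -deg_scale_sym //; apply: tens_cat; last exact: pbwS.
  by apply: tens_deg_scale; exact: pbwS.
rewrite (sum_unshuffles_le1 F) /F sym_nil cat_malg0s mulrS scalerDl scale1r.
congr (_ + _); rewrite -tensZ sym_picks // tens_sum.
by apply: eq_bigr => q _; rewrite sym1 // cat_malg1.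
Qed.

(** ** The ideal and the kernel of the straightening map *)

Hypothesis b_br : forall x y, top x y -> b x y = br x y.

Local Notation F := (Floc top).
Local Notation U := (Uloc top br).
Local Notation good := (pairwise top).

Definition ucls (f : F) : U := Uproj br (Tproj f).

Fact ucls_is_linear : linear ucls.
Proof. by move=> c f h; rewrite /ucls TprojP; exact: linearP. Qed.
HB.instance Definition _ := GRing.isLinear.Build K F U _ ucls ucls_is_linear.

Lemma ucls_exists (y : U) : exists f, y = ucls f.
Proof.
have [t ->] : exists t, y = Uproj br t by exact: qprojP.
by have [f ->] := Tproj_exists t; exists f.
Qed.

Lemma ucls_eq0 f : ucls f = 0 <-> Tproj f \in Jloc top br.
Proof. exact: qproj_eq0. Qed.

Lemma ucls_tens f h : tens (Fincl f) = tens (Fincl h) -> ucls f = ucls h.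
Proof. by move/Tproj_eq; rewrite /ucls => ->. Qed.

Definition pbw_kernel : {pred Tloc top} := fun t =>
  `[< exists2 f : F, t = Tproj f & tens (pbw (Fincl f)) = 0 >].

Lemma pbw_kernelP (f : F) : reflect (tens (pbw (Fincl f)) = 0) (Tproj f \in pbw_kernel).
Proof.
apply: (iffP (asboolP _)) => [[h /Tproj_eq fh]|]; last by exists f.
by rewrite (tens_pbw b_linl b_linr fh).
Qed.

Lemma pbw_kernel_closed : submod_closed pbw_kernel.
Proof.
split=> [|c s t].
  have <- : Tproj 0 = 0 :> Tloc top by exact: linear0.
  by apply/pbw_kernelP; rewrite !linear0.
have [f ->] := Tproj_exists s; have [h ->] := Tproj_exists t.
move=> /pbw_kernelP f0 /pbw_kernelP h0; rewrite -TprojP; apply/pbw_kernelP.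
by rewrite !linearP /= f0 h0 scaler0 addr0.
Qed.

Lemma good_context n (f : F) (v : iword top) :
  f \in Ffilt top n -> (forall s, s \in msupp f -> allrel top (sval s) (sval v)) ->
  Fincl f \in supported (fun w => good (sval v ++ w) /\ (size w <= n)%N).
Proof.
move=> /allP fn fv; rewrite FinclE unlock; apply: supported_sum => u uf.
apply: supportedZ; apply: supportedU; split; last exact: fn.
rewrite pairwise_cat -!(indepE topC) (valP u) (valP v) !andbT.
by rewrite allrelC (eq_allrel (r' := top)) ?fv // => x y; rewrite topC.
Qed.

(** A product is computed on independent representatives, to which [pbw_catr] and
    [pbw_catl] apply word by word. *)
Lemma pbw_kernel_ideal : locality_ideal pbw_kernel.
Proof.
split=> [|s t r]; first exact: pbw_kernel_closed.
move=> sI _; split=> -[n [f [h [fn hn /toptimesP fh [es et ->]]]]].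
  move: sI; rewrite es => /pbw_kernelP f0; apply/pbw_kernelP.
  rewrite FincLmul; [|exact: topC | exact/toptimesP].
  rewrite {2}/Fincl /cat_malg bilext_sumr linear_sum tens_sum big_seq.
  apply: big1 => v vh; rewrite bilextZr linearZ tensZ.
  rewrite (pbw_catr (n := n)).
  - by rewrite scaler0.
  - by apply: good_context => // u uf; exact: fh.
  - exact: f0.
move: sI; rewrite et => /pbw_kernelP h0; apply/pbw_kernelP.
rewrite FincLmul; [|exact: topC | exact/toptimesP].
rewrite {1}/Fincl /cat_malg bilext_suml linear_sum tens_sum big_seq.
apply: big1 => u uf; rewrite bilextZl linearZ tensZ.
rewrite (pbw_catl (n := n)).
- by rewrite scaler0.
- apply: good_context => // v vh; rewrite allrelC.
  by rewrite (eq_allrel (r' := top)) ?fh // => x y; rewrite topC.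
- exact: h0.
Qed.

(** [Jloc] is the smallest locality ideal containing the relations
    [x y - y x - br x y], so it is contained in the kernel of [pbw]. *)
Lemma pbw_ucls0 f : ucls f = 0 -> tens (pbw (Fincl f)) = 0.
Proof.
move=> /ucls_eq0/asboolP/(_ _ pbw_kernel_ideal) Jf; apply/pbw_kernelP/Jf.
move=> _ [x [y [xy ->]]].
have gxy : good [:: x; y] by rewrite /= xy.
have gyx : good [:: y; x] by rewrite /= topC xy.
rewrite /tens2 -!linearB; apply/pbw_kernelP.
rewrite !linearB /= !Fincl_word //= -(b_br xy).
have := @env_swap [::] 2 [::] x y [::] gxy isT; rewrite -envD.
move/env_pbw => e.
by rewrite -addrA -opprD -tensD -linearD -e subrr.
Qed.

Local Notation cls w := (ucls (word top w)).

Variable mU : U -> U -> U.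
Hypothesis hmU : induced_product mU.

Lemma mU_ucls f h : toptimes top f h -> mU (ucls f) (ucls h) = ucls (Fmul f h).
Proof. by move=> fh; apply: hmU; exact: Tprod_cat. Qed.

Lemma Fmul_word u v : good (u ++ v) ->
  Fmul (word top u) (word top v) = word top (u ++ v).
Proof.
move=> guv; have := guv; rewrite pairwise_cat => /and3P[uv gu gv].
apply: Fincl_inj; rewrite FincLmul //; last exact: toptimes_word.
by rewrite !Fincl_word // cat_malgUU.
Qed.

Lemma mU_word u v : good (u ++ v) -> mU (cls u) (cls v) = cls (u ++ v).
Proof.
move=> guv; rewrite mU_ucls ?Fmul_word //; apply: toptimes_word.
by move: guv; rewrite pairwise_cat => /and3P[].
Qed.

(** A locality ideal is only stable under products with elements related to the
    whole ideal. The existence of the induced product gives more: since [f] and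
    [0] have the same class, so have their products with [h]. *)
Lemma ucls_mulr f h : toptimes top f h -> ucls f = 0 -> ucls (Fmul f h) = 0.
Proof.
move=> fh f0; rewrite -mU_ucls // f0 -(linear0 ucls) mU_ucls; last exact: toptimes0.
by congr ucls; rewrite FmulE /bilext linear0.
Qed.

Lemma ucls_mull f h : toptimes top h f -> ucls f = 0 -> ucls (Fmul h f) = 0.
Proof.
move=> hf f0; rewrite -mU_ucls // f0 -(linear0 ucls) mU_ucls.
  by congr ucls; rewrite FmulE bilextC linear0.
by apply: toptimesC => //; exact: toptimes0.
Qed.

Lemma good_swap u x y v : good (u ++ x :: y :: v) -> good (u ++ y :: x :: v).
Proof.
have pxy : perm_eq (u ++ x :: y :: v) (u ++ y :: x :: v).
  by rewrite perm_cat2l (perm_catCA [:: x] [:: y] v).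
by rewrite (perm_pairwise topC pxy).
Qed.

(** The relation for the two-letter word, multiplied by [v] and then by [u]. *)
Lemma ucls_swap u x y v : good (u ++ x :: y :: v) ->
  ucls (word top (u ++ x :: y :: v) - word top (u ++ y :: x :: v)
        - word top (u ++ b x y :: v)) = 0.
Proof.
pose d u v : F := word top (u ++ x :: y :: v) - word top (u ++ y :: x :: v)
        - word top (u ++ b x y :: v).
pose D u v : M := << u ++ x :: y :: v >> - << u ++ y :: x :: v >>
        - << u ++ b x y :: v >>.
have gb w w' : good (w ++ x :: y :: w') -> good (w ++ b x y :: w').
  exact: (good_bracket (C := [::])).
have dD w w' : good (w ++ x :: y :: w') -> Fincl (d w w') = D w w'.
  move=> g'; rewrite !linearB /= !Fincl_word //; first exact: gb.
  exact: good_swap.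
have DP (P : seq V -> Prop) w w' : P (w ++ x :: y :: w') ->
    P (w ++ y :: x :: w') -> P (w ++ b x y :: w') -> D w w' \in supported P.
  by move=> P1 P2 P3; rewrite /D !supportedB ?supportedU.
have Dr w w' : cat_malg (D w [::]) << w' >> = D w w'.
  by rewrite /D /cat_malg !bilextBl !bilextUU -!catA.
have Dl w w' : cat_malg << w >> (D [::] w') = D w w'.
  by rewrite /D !linearB /= !cat_malgUU.
move=> guv; have := guv; rewrite pairwise_cat => /and3P[_ gu gxyv].
have gxy : good [:: x; y].
  by move: gxyv; rewrite -[x :: y :: v]/([:: x; y] ++ v) pairwise_cat => /and3P[].
have gv : good v by move: gxyv => /= /and3P[].
have xy : top x y by move: gxy; rewrite /= !andbT.
have d0 : ucls (d [::] [::]) = 0.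
  apply/ucls_eq0/asboolP => I hI hr; apply: hr.
  by exists x, y; split=> //; rewrite /tens2 -(b_br xy) -!linearB.
have d1 : ucls (d [::] v) = 0.
  have t1 : toptimes top (d [::] [::]) (word top v).
    apply: (@toptimes_supported _ _ _ (fun w => good (w ++ v)) (eq v)).
    - rewrite dD //; apply: DP => //; first exact: (good_swap (u := [::])).
      exact: (gb [::] v).
    - by rewrite Fincl_word //; apply: supportedU.
    - by move=> w _ + <-; rewrite pairwise_cat => /and3P[].
  have <- : Fmul (d [::] [::]) (word top v) = d [::] v.
    by apply: Fincl_inj; rewrite FincLmul // !dD // Fincl_word.
  exact: ucls_mulr d0.
have t2 : toptimes top (word top u) (d [::] v).
  apply: (@toptimes_supported _ _ _ (eq u) (fun w => good (u ++ w))).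
  - by rewrite Fincl_word //; apply: supportedU.
  - rewrite dD //; apply: DP => //; first exact: good_swap.
    exact: gb.
  - by move=> _ w <-; rewrite pairwise_cat => /and3P[].
rewrite -/(d u v); have <- : Fmul (word top u) (d [::] v) = d u v.
  by apply: Fincl_inj; rewrite FincLmul // !dD // Fincl_word.
exact: ucls_mull d1.
Qed.

Lemma ucls_env n f : env [::] n (Fincl f) = 0 -> ucls f = 0.
Proof.
move=> /env_eq0; move hf : (Fincl f) => h hrel.
suff [f0 hf0 <-] : exists2 f0, tens h = tens (Fincl f0) & ucls f0 = 0.
  by apply: ucls_tens; rewrite hf hf0.
move: h {hf} hrel; apply: lspan_ind => [|c h h' [e he e0] [e' he' e'0]|h].
- by exists 0; [rewrite (linear0 (@Fincl K V top)) | exact: linear0].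
- by exists (c *: e + e'); rewrite !linearP /= ?he ?he' // e0 e'0 scaler0 addr0.
- case=> [u x y v guv _|{}h /tens_eq0 h0]; last first.
    by exists 0; [rewrite (linear0 (@Fincl K V top)) h0 tens0 | exact: linear0].
  exists (word top (u ++ x :: y :: v) - word top (u ++ y :: x :: v)
        - word top (u ++ b x y :: v)); last exact: ucls_swap.
  rewrite !linearB /= !Fincl_word //; last exact: good_swap.
  exact: (good_bracket (C := [::]) guv).
Qed.

Local Notation one := (Uone top br).
Local Notation topUg := (topU top br).

(** ** The embedding into the tensor algebra *)

Definition urep (y : U) : F := sval (cid (ucls_exists y)).

Lemma urepK : cancel urep ucls.
Proof. by move=> y; rewrite /urep; case: cid. Qed.

Definition upbw (y : U) : tensor V := tens (pbw (Fincl (urep y))).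

Lemma upbwE f : upbw (ucls f) = tens (pbw (Fincl f)).
Proof.
apply/eqP; rewrite -subr_eq0 -tensB -linearB -linearB; apply/eqP.
apply: pbw_ucls0.
by rewrite linearB /= urepK subrr.
Qed.

Fact upbw_is_linear : linear upbw.
Proof.
move=> c y z; rewrite -[y]urepK -[z]urepK -linearP !upbwE.
by rewrite linearP [pbw _]linearP tensD tensZ.
Qed.
HB.instance Definition _ := GRing.isLinear.Build K U (tensor V) _ upbw upbw_is_linear.

Lemma upbw_word w : good w -> upbw (cls w) = tens (pbw << w >>).
Proof. by move=> gw; rewrite upbwE Fincl_word. Qed.

Lemma upbw_Floc_of f : f \in supported good -> upbw (ucls (Floc_of top f)) = tens (pbw f).
Proof. by move=> gf; rewrite upbwE Floc_ofK. Qed.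

(** A word is congruent to its symmetric representative, so an element whose
    representative vanishes as a tensor is zero: symmetric representatives embed
    the enveloping algebra into the tensor algebra. *)
Lemma upbw_inj y : upbw y = 0 -> y = 0.
Proof.
rewrite -[y]urepK upbwE => y0; have [n fn] := Ffilt_exists (urep y).
apply: (ucls_env (n := n)).
rewrite -(env_pbw_id (C := [::])); first exact: env_tens0.
apply: supportedP => w; rewrite -mcoeff_neq0 Fincl_coef; case: insubP => [u gu uw|].
  rewrite mcoeff_neq0 -uw => uf; split; last exact: (allP fn).
  by rewrite -(indepE topC); exact: (valP u).
by rewrite eqxx.
Qed.

Lemma ucls_env_eq n f f' : f \in supported good -> f' \in supported good ->
  env [::] n f = env [::] n f' -> ucls (Floc_of top f) = ucls (Floc_of top f').
Proof.
move=> gf gf' ff'; apply/eqP; rewrite -subr_eq0 -!linearB; apply/eqP.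
apply: (ucls_env (n := n)).
rewrite Floc_ofK // ?supportedB //.
by apply/eqP; rewrite linearB subr_eq0; apply/eqP.
Qed.

(** ** The coproduct of words *)

Variable Delta : {linear U -> Tloc topUg}.
Hypothesis hDelta : is_coproduct mU Delta.

Lemma topU_sym : symmetric topUg.
Proof.
suff sym x y : topUg x y -> topUg y x by move=> x y; apply/idP/idP; exact: sym.
move=> /asboolP[s [t [-> -> /asboolP[n [f [h [fn hn -> -> fh]]]]]]].
apply/asboolP; exists (Tproj h), (Tproj f); split=> //; apply/asboolP.
by exists n, h, f; split=> //; exact: toptimesC.
Qed.

Lemma topU_ucls f h : toptimes top f h -> topUg (ucls f) (ucls h).
Proof.
move=> fh; apply/asboolP; exists (Tproj f), (Tproj h); split=> //.
exact: topotimes_Tproj.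
Qed.

Lemma topU_word u v : allrel top u v -> topUg (cls u) (cls v).
Proof. by move=> uv; apply: topU_ucls; exact: toptimes_word. Qed.

Lemma topU1 y : topUg y one.
Proof.
rewrite -[y]urepK; apply: topU_ucls; apply/toptimesP => u v _.
rewrite /word; case: insubP => [w _ w0|_] /=; last by rewrite msupp0 inE.
by move/mem_msuppU=> ->; rewrite w0 allrel0r.
Qed.

Definition pair_word (a c : U) : Floc topUg := word topUg [:: a; c].

Lemma Fincl_pair_word a c : topUg a c -> Fincl (pair_word a c) = << [:: a; c] >>.
Proof. by move=> ac; rewrite Fincl_word //; [exact: topU_sym | rewrite /= ac]. Qed.

Lemma bilext_pair_word (W : lmodType K) (G : iword topUg -> iword topUg -> W)
    (G' : U -> U -> U -> U -> W) a c a' c' :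
  (forall s t, G s t = G' (sval s)`_0 (sval s)`_1 (sval t)`_0 (sval t)`_1) ->
  topUg a c -> topUg a' c' ->
  bilext G (pair_word a c) (pair_word a' c') = G' a c a' c'.
Proof.
move=> GG' ac ac'; rewrite /pair_word /word.
have gw (e e' : U) : topUg e e' -> indep topUg [:: e; e'].
  by move=> ee'; rewrite indepE //= ?ee' //; exact: topU_sym.
case: insubP => [s _ es|]; last by rewrite gw.
case: insubP => [t _ et|]; last by rewrite gw.
by rewrite bilextUU GG' es et.
Qed.

(** The letter [x] is primitive, so multiplying by it adds it to either of the two
    subwords of each unshuffle of [w]. *)
Lemma Delta_word w : good w ->
  Delta (cls w) = Tproj (\sum_(p <- unshuffles w) pair_word (cls p.1) (cls p.2)).
Proof.
elim: w => [|x w IHw] gxw; first by rewrite big_seq1; exact: (coproduct_one hDelta).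
have gw : good w by move: gxw => /= /andP[].
have gx : good [:: x] by [].
have xw : allrel top [:: x] w.
  by move: gxw; rewrite -cat1s pairwise_cat => /and3P[].
have unsh (r : seq V * seq V) : r \in unshuffles w ->
    [/\ good (x :: r.1), good (x :: r.2) & good r.1 /\ good r.2] /\
    [/\ allrel top (x :: r.1) r.2, allrel top r.1 (x :: r.2) & allrel top r.1 r.2].
  move=> /unshuffles_perm rw.
  have g1 : good ((x :: r.1) ++ r.2).
    by rewrite (perm_pairwise topC (t := x :: w)) //= perm_cons.
  have g2 : good (r.1 ++ x :: r.2).
    rewrite (perm_pairwise topC (t := x :: w)) // -(cat1s x r.2) perm_catCA /=.
    by rewrite perm_cons.
  move: g1 g2; rewrite !pairwise_cat => /and3P[a1 b1 c1] /and3P[a2 b2 c2].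
  split; split=> //.
  by move: a1; rewrite allrel_consl => /andP[].
pose Q := \sum_(p <- unshuffles w) pair_word (cls p.1) (cls p.2).
pose P := pair_word (cls [:: x]) one + pair_word one (cls [:: x]).
have QP : Fincl Q = \sum_(p <- unshuffles w) << [:: cls p.1; cls p.2] >>.
  rewrite linear_sum big_seq [RHS]big_seq; apply: eq_bigr => p /unsh[_ [_ _ a3]].
  by apply: Fincl_pair_word; exact: topU_word.
have x1 : topUg (cls [:: x]) one by exact: topU1.
have PP : Fincl P = << [:: cls [:: x]; one] >> + << [:: one; cls [:: x]] >>.
  by rewrite linearD /= !Fincl_pair_word // topU_sym.
have sP : Fincl P \in supported (fun s =>
    s = [:: cls [:: x]; one] \/ s = [:: one; cls [:: x]]).
  by rewrite PP supportedD ?supportedU //; [left | right].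
have sQ : Fincl Q \in supported (fun s => exists2 r : seq V * seq V,
    r \in unshuffles w & s = [:: cls r.1; cls r.2]).
  by rewrite QP; apply: supported_sum => p pw; apply: supportedU; exists p.
have PQ : toptimes topUg P Q.
  apply: (toptimes_supported sP sQ) => s t Ps [p /unsh[[g1 g2 [g3 g4]] _] ->].
  have xu u : good (x :: u) -> topUg (cls [:: x]) (cls u).
    by rewrite -cat1s pairwise_cat => /and3P[xu _ _]; exact: topU_word.
  have u1 u : topUg one (cls u) by rewrite topU_sym; exact: topU1.
  by case: Ps => ->; rewrite /allrel /= !xu // !u1.
have := coproduct_mul hDelta (topU_word xw) (p := P) (q := Q) _ _ PQ _ (IHw gw).
case.
- by apply/FdegP; apply: sub_supported sP => s [] ->.
- by apply/FdegP; apply: sub_supported sQ => s [p _ ->].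
- rewrite -[cls [:: x]]/(iota_lie top br x) (coproduct_iota hDelta) /tens2.
  exact/esym/linearD.
move=> f; rewrite mU_word // => -> fP; apply/Tproj_eq.
have -> : tens (Fincl f) = tens (UUmul mU P Q) by apply/tens_eq.
pose G (s t : iword topUg) : {malg K[seq U]} :=
  << [:: mU (sval s)`_0 (sval t)`_0; mU (sval s)`_1 (sval t)`_1] >>.
have GE a c a' c' : topUg a c -> topUg a' c' ->
    bilext G (pair_word a c) (pair_word a' c') = << [:: mU a a'; mU c c'] >>.
  exact: (bilext_pair_word (G' := fun a c a' c' => << [:: mU a a'; mU c c'] >>)).
congr tens; rewrite /UUmul -(bilextE G).
rewrite linear_sum bilext_sumr sum_unshuffles_cons big_seq [RHS]big_seq.
apply: eq_bigr => r /unsh[[g1 g2 [g3 g4]] [a1 a2 a3]].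
have mX u : good (x :: u) -> mU (cls [:: x]) (cls u) = cls (x :: u).
  by move=> gu; rewrite mU_word.
have m1 u : good u -> mU one (cls u) = cls u.
  by move=> gu; rewrite -[one]/(cls [::]) mU_word.
have r12 := topU_word a3; have x1' : topUg one (cls [:: x]) by rewrite topU_sym.
rewrite /P bilextDl (GE _ _ _ _ x1 r12) (GE _ _ _ _ x1' r12).
rewrite (mX _ g1) (mX _ g2) (m1 _ g3) (m1 _ g4) /=.
by congr (_ + _); apply/esym/Fincl_pair_word; exact: topU_word.
Qed.

(** ** Primitive elements *)

(** [conv_form] transported to the enveloping algebra. Unlike the product [mU], it
    is bilinear on all pairs, hence can be applied to tensors. *)
Definition Uform (y z : U) : tensor V := tmul (tscale le1 (upbw y)) (upbw z).

Lemma Uform_linl z : linear (Uform^~ z).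
Proof. by move=> c y y'; rewrite /Uform !linearP tmulPl. Qed.

Lemma Uform_linr y : linear (Uform y).
Proof. by move=> c z z'; rewrite /Uform linearP tmulPr. Qed.

Lemma Uform_word u v : good u -> good v ->
  Uform (cls u) (cls v) = conv_form u v.
Proof. by move=> gu gv; rewrite /Uform !upbw_word // tscaleE tmulE. Qed.

Definition tpairing (t : Tloc topUg) : tensor V :=
  pairing Uform (Fincl (sval (cid (Tproj_exists t)))).

Lemma tpairingE (f : Floc topUg) : tpairing (Tproj f) = pairing Uform (Fincl f).
Proof.
apply: pairing_tens; [exact: Uform_linl | exact: Uform_linr |].
by apply/Tproj_eq; case: cid.
Qed.

Fact tpairing_is_linear : linear tpairing.
Proof.
move=> c s t; have [f ->] := Tproj_exists s; have [h ->] := Tproj_exists t.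
by rewrite -TprojP !tpairingE linearP [pairing _ _]linearP.
Qed.
HB.instance Definition _ :=
  GRing.isLinear.Build K (Tloc topUg) (tensor V) _ tpairing tpairing_is_linear.

Lemma tpairing_tens2 y z : topUg y z -> tpairing (tens2 topUg y z) = Uform y z.
Proof.
by move=> yz; rewrite /tens2 tpairingE Fincl_pair_word // pairingU.
Qed.

Lemma tpairing_Delta_word w : good w ->
  tpairing (Delta (cls w)) = unshuffle_pairing conv_form << w >>.
Proof.
move=> gw; rewrite Delta_word // tpairingE.
rewrite (linear_sum (@Fincl K U topUg)) (linear_sum (pairing Uform)).
rewrite /unshuffle_pairing linextU big_seq [RHS]big_seq; apply: eq_bigr => p.
move=> /unshuffles_perm pw.
have : good (p.1 ++ p.2) by rewrite (perm_pairwise topC pw).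
rewrite pairwise_cat => /and3P[a12 g1 g2].
by rewrite /= Fincl_pair_word ?pairingU ?Uform_word //; exact: topU_word.
Qed.

Lemma tpairing_Delta_sym w : good w ->
  tpairing (Delta (ucls (Floc_of top (sym w)))) = (size w).+1%:R *: tens (sym w).
Proof.
move=> gw.
rewrite -(conv_sym gw).
have gs := sym_good (C := [::]) gw.
pose L : {linear M -> tensor V} := tpairing \o (Delta \o (ucls \o Floc_of top)).
apply: (eq_on_supported (L := L) (L' := unshuffle_pairing conv_form) _ gs).
by move=> s [gs' _]; rewrite /L /= Floc_ofU tpairing_Delta_word.
Qed.

(** Both sides are linear in [y], and the enveloping algebra is spanned by the
    classes of symmetrized words: the class of [w] is the sum of those of [sym w]
    and of the shorter [defect w]. *)
Lemma tpairing_Delta y :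
  tpairing (Delta y) = tscale (fun n => n.+1%:R) (upbw y).
Proof.
pose L : {linear U -> tensor V} := tpairing \o Delta.
pose L' : {linear U -> tensor V} := tscale (fun n => n.+1%:R) \o upbw.
rewrite -[LHS]/(L y) -[RHS]/(L' y).
have word w : good w -> L (cls w) = L' (cls w).
  have [n] := ubnP (size w); elim: n w => // n IHn w; rewrite ltnS => szw gw.
  have sg : sym w \in supported good.
    by apply: sub_supported (sym_good (C := [::]) gw) => s [].
  have dg := defect_good (C := [::]) gw.
  have dg' : defect w \in supported good by apply: sub_supported dg => s [].
  have -> : cls w = ucls (Floc_of top (sym w)) + ucls (Floc_of top (defect w)).
    rewrite -linearD -linearD -Floc_ofU; apply: (ucls_env_eq (n := size w)).
    - exact: supportedU.
    - exact: supportedD.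
    - by rewrite linearD; exact: (@env_sym_defect [::] _ w gw (leqnn _)).
  rewrite [LHS]linearD [RHS]linearD; congr (_ + _).
    rewrite /L /= tpairing_Delta_sym // /L' /= upbw_Floc_of //.
    rewrite (pbw_sym gw).
    by rewrite tscaleE deg_scale_sym // tensZ.
  case: w => [|x w] in szw gw sg dg dg' *; first by rewrite /defect /= !linear0.
  pose LF := L \o (ucls \o Floc_of top); pose LF' := L' \o (ucls \o Floc_of top).
  apply: (eq_on_supported (L := LF) (L' := LF') _ dg) => s [gs /= szs].
  by rewrite /LF /LF' /= Floc_ofU; apply: IHn; rewrite // szs.
rewrite -[y]urepK -[urep y]FinclK //.
pose LF := L \o (ucls \o Floc_of top); pose LF' := L' \o (ucls \o Floc_of top).
apply: (eq_on_supported (L := LF) (L' := LF') _ (Fincl_supported topC (urep y))).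
by move=> s gs; rewrite /LF /LF' /= Floc_ofU; exact: word.
Qed.

Lemma upbw_one : upbw one = tens << [::] >>.
Proof. by rewrite -[one]/(cls [::]) upbw_word // pbw_nil. Qed.

(** The pairing of [y (x) 1 + 1 (x) y] is the part of degree at most one of the
    representative of [y], plus this representative. *)
Lemma primitive_degrees y : primitive_elt Delta y ->
  tscale (fun n => n.+1%:R) (upbw y) = tscale le1 (upbw y) + upbw y.
Proof.
move=> py; rewrite -tpairing_Delta py linearD /=.
have oney : topUg one y by rewrite topU_sym; exact: topU1.
rewrite !tpairing_tens2 //; last exact: topU1.
rewrite /Uform upbw_one tmul1r tscaleE deg_scaleU /le1 /= scale1r tmul1l.
by [].
Qed.

(** In degree [n] the equation of [primitive_degrees] multiplies the component by
    [n - 1] for [n = 0] and by [n] for [n >= 2], so only degree one remains. *)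
Lemma primitive_in_image y : primitive_elt Delta y ->
  exists x : V, y = iota_lie top br x.
Proof.
move=> /primitive_degrees; set q := upbw y => qE.
pose c n : K := n.+1%:R - (le1 n + 1).
have cq : tens (deg_scale c (trep q)) = 0.
  have e : deg_scale (fun n => n.+1%:R) (trep q) = deg_scale c (trep q) +
      (deg_scale le1 (trep q) + deg_scale (fun=> 1) (trep q)).
    rewrite -!deg_scaleD; congr (deg_scale _ _).
    by apply: funext => n; rewrite /c subrK.
  have -> : deg_scale c (trep q) = deg_scale (fun n => n.+1%:R) (trep q) -
      (deg_scale le1 (trep q) + trep q) by rewrite e deg_scale1 addrK.
  by rewrite tensB tensD trepK; apply/eqP; rewrite subr_eq0; apply/eqP.
have q1 : q = tens (deg_scale (fun n => (n == 1)%:R) (trep q)).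
  rewrite -{1}[q]trepK -{1}[trep q]deg_scale1.
  have -> : (fun=> 1) = (fun n : nat => (n == 1)%:R + (n != 1)%:R :> K).
    by apply: funext => n; case: eqP; rewrite ?addr0 ?add0r.
  rewrite deg_scaleD tensD -[RHS]addr0; congr (_ + _).
  pose d n : K := if n == 1 then 0 else (c n)^-1.
  (* [c] vanishes at 1 only, since the characteristic is zero. *)
  have -> : (fun n : nat => (n != 1)%:R) = (fun n => c n * d n).
    apply: funext => -[|[|n]]; rewrite /d /c /le1 /= ?mulr0 //.
      by rewrite divff // opprD addrA subrr sub0r oppr_eq0 oner_eq0.
    by rewrite add0r -[n.+3%:R]natr1 addrK divff ?char0.
  by rewrite -deg_scale_comp -tscaleE cq; exact: linear0.
have [x qx] := deg_scale_one (trep q).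
exists x; apply/eqP; rewrite -subr_eq0; apply/eqP/upbw_inj.
have -> : upbw (y - iota_lie top br x) = q - upbw (cls [:: x]) by exact: linearB.
by rewrite q1 qx upbw_word // pbw1 subrr.
Qed.

End Enveloping.

(** * The characteristic of the base field *)

Lemma char0_real_or_complex (K : fieldType) :
  real_or_complex K -> forall n, n.+1%:R != 0 :> K.
Proof.
by case=> R [[f _]|[f _]] n; rewrite -(rmorph_nat f) fmorph_eq0 Num.Theory.pnatr_eq0.
Qed.

Unset Implicit Arguments.

Theorem proposition9p3 (K : fieldType) (hK : real_or_complex K)
  (g : lmodType K) (top : rel g) (br : g -> g -> g)
  (hg : locality_lie_algebra top br)
  (ha : forall n : nat,
    locality_compatible (Ffilt top n) (toptimes top)
      (Imult_loc top (leq^~ n)))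
  (hb : locality_compatible predT (topotimes top) (Jloc top br))
  (mU : Uloc top br -> Uloc top br -> Uloc top br)
  (hmU : induced_product mU)
  (Delta : {linear Uloc top br -> Tloc (topU top br)})
  (hDelta : is_coproduct mU Delta)
  (y : Uloc top br) :
  primitive_elt Delta y <-> exists x : g, y = iota_lie top br x.
Proof.
split=> [py|[x ->]]; last exact: (coproduct_iota hDelta).
case: hg => [[topC _ _] [br_bil br_anti _ br_polar br_jacobi]].
have [b [b_linl b_linr b_br]] := bracket_extension topC br_bil.
have br_top x z t : top x z -> top x t -> top z t -> top (br x z) t.
  move=> xz xt zt; have polarP s : top s t -> s \in polar top (pred1 t).
    by move=> st; apply/asboolP => u /eqP->.
  have /asboolP/(_ t) := br_polar (pred1 t) x z (polarP x xt) (polarP z zt) xz.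
  by apply; exact: eqxx.
have b_top x z t : top x z -> top x t -> top z t -> top (b x z) t.
  by move=> xz; rewrite b_br //; exact: br_top.
have b_anti x z : top x z -> b x z = - b z x.
  by move=> xz; rewrite (b_br x z) // (b_br z x) 1?topC //; exact: br_anti.
have b_jacobi x z t : top x z -> top z t -> top x t ->
    b x (b z t) + b z (b t x) + b t (b x z) = 0.
  move=> xz zt xt; rewrite -[RHS](br_jacobi x z t) //.
  have [zx tz tx] : [/\ top z x, top t z & top t x].
    by split; rewrite topC.
  rewrite (b_br z t) // (b_br t x) // (b_br x z) //.
  by rewrite !b_br // topC; apply: br_top.
exact: (primitive_in_image (char0_real_or_complex hK) topC b_linl b_linr b_anti
  b_top b_jacobi b_br hmU hDelta py).
Qed.
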